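(* (a) The holomorphic fiber bundle with fiber $\mathbb C^2$ in Skoda's example of a non-Stein bundle, in either of its two versions described in the context, extends to a holomorphic fiber bundle with fiber $\mathbb C^2$ over the Riemann sphere $S=\mathbb C\cup\{\infty\}$ (and so to a holomorphic fiber bundle over the unit disc). (b) Let $k\ge 2$ be an integer, let $0<r<R<\infty$, let $A=\{\zeta\in\mathbb C: r<|\zeta|<R\}$, and let $X_k\to A$ be the holomorphic fiber bundle with fiber $\mathbb C^2$ over $A$ defined by the gluing automorphism $(z_1,z_2)\mapsto(z_2,-z_1+z_2^k)$. Then $X_k$ extends to a holomorphic fiber bundle with fiber $\mathbb C^2$ over the Riemann sphere $S$ whose gluing automorphisms of the fibers, in appropriate local trivializations, are polynomial automorphisms of $\mathbb C^2$ (allowed to depend on the base point).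
   Context: A bundle $X\to\Lambda$ over an open set $\Lambda\subset S$ extends to a bundle $\tilde X\to B$, where $\Lambda\subset B\subset S$ is open, if the restriction of $\tilde X$ over $\Lambda$ is isomorphic to $X$ by a biholomorphic map of total spaces covering the identity of $\Lambda$. All bundles are locally trivial holomorphic fiber bundles; their transition maps have the form $(\zeta,z)\mapsto(\zeta,g_{\alpha\beta}(\zeta)(z))$, holomorphic in $(\zeta,z)$, where each $g_{\alpha\beta}(\zeta)$ is a holomorphic automorphism of the fiber $\mathbb C^2$. Bundles defined by gluing automorphisms: let $\Lambda$ be the unit disc with $N$ pairwise disjoint closed discs $\overline{D_1},\dots,\overline{D_N}$ removed, and let $f_1,\dots,f_N$ be automorphisms of $\mathbb C^2$. Choose pairwise disjoint arcs $\gamma_j$ in $\Lambda$ joining $\partial D_j$ to the unit circle, so that $\Lambda\setminus\bigcup_j\gamma_j$ is simply connected. The bundle defined by the gluing automorphism $f_j$ around $D_j$, $j=1,\dots,N$, is obtained from the trivial bundle with fiber $\mathbb C^2$ over $\Lambda$ cut along the arcs $\gamma_j$ by gluing its two sides along each $\gamma_j$ by $(\zeta,z)\mapsto(\zeta,f_j(z))$ when $\gamma_j$ is crossed counterclockwise around $D_j$. Its transition automorphisms are thus locally independent of the base point. Similarly, the bundle over the annulus $A$ defined by the gluing automorphism $f$ is obtained from the trivial bundle over $A$ cut along a radius by gluing the two sides by $(\zeta,z)\mapsto(\zeta,f(z))$ when the radius is crossed counterclockwise; equivalently, it is the quotient of $\tilde A\times\mathbb C^2$, with $\tilde A$ the universal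 cover of $A$, by the group generated by the generating deck transformation of $\tilde A$ acting together with $f$ on $\mathbb C^2$. Skoda's example, as described in the paper, has two versions. First version: the base is the unit disc with $8$ pairwise disjoint closed discs removed, and around each deleted disc the bundle is defined by a gluing automorphism which, up to a possible permutation of the coordinates, is an over-shear, i.e. is of the form $(z_1,z_2)\mapsto(z_1,z_2e^{Q(z_1)})$ or $(z_1,z_2)\mapsto(z_1e^{Q(z_2)},z_2)$ with $Q$ an entire function. Second version: the base is the unit disc with $2$ disjoint closed discs removed; around one deleted disc the gluing automorphism is $(z_1,z_2)\mapsto(z_1,z_2e^{z_1})$ and around the other it is $(z_1,z_2)\mapsto(iz_2,z_1)$. A polynomial automorphism of $\mathbb C^2$ is a bijective polynomial map $\mathbb C^2\to\mathbb C^2$ with polynomial inverse. *)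

(* Defs.v *)
From HB Require Import structures.
From mathcomp Require Import all_boot all_order all_algebra.
From mathcomp Require Import complex.
From mathcomp Require Import all_classical all_reals all_analysis.

Set Implicit Arguments.
Unset Strict Implicit.
Unset Printing Implicit Defensive.

Import Order.TTheory GRing.Theory Num.Theory.
Import numFieldNormedType.Exports.

Local Open Scope classical_set_scope.
Local Open Scope ring_scope.

Notation Cplx R := (R[i]^o).
Notation C2 R := (Cplx R * Cplx R)%type.

(* S = C u {oo}, with Some z for a finite point z and None for oo. *)
Notation sphere R := (one_point_compactification (Cplx R)).

Section Holomorphy.
Variable R : realType.
Local Notation C := (Cplx R).

Definition cexp (z : C) : C :=
  (expR (complex.Re z) * cos (complex.Im z)
    +i* (expR (complex.Re z) * sin (complex.Im z)))%C.

Definition entire (Q : C -> C) : Prop := forall z, differentiable Q z.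

(* The chart w |-> 1/w of the sphere centred at oo. *)
Definition sphere_inv (w : C) : sphere R :=
  if w == 0 then None else Some w^-1.

(* C-differentiability of g at the point (p, z) of S x C^2, read in the chart
   of S centred at p. On an open set, C-differentiability at every point is
   holomorphy in all the variables jointly. *)
Definition hol_at (g : sphere R -> C2 R -> C2 R) (p : sphere R) (z : C2 R) :
    Prop :=
  match p with
  | Some a => differentiable (fun x : C * C2 R => g (Some x.1) x.2) (a, z)
  | None => differentiable (fun x : C * C2 R => g (sphere_inv x.1) x.2)
                           ((0 : C), z)
  end.

(* g is only meaningful over U, which is always open below. *)
Definition hol_over (U : set (sphere R)) (g : sphere R -> C2 R -> C2 R) :
    Prop :=
  forall p z, U p -> hol_at g p z.

End Holomorphy.

Section Bundles.
Variable R : realType.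
Local Notation C := (Cplx R).
Local Notation S := (sphere R).

(* A locally trivial holomorphic bundle with fiber C^2 over B. The topology and
   the complex structure of the total space are those for which the
   trivializations e |-> (proj e, coord i e) are biholomorphic. That each
   trans i j p with p in dom i and dom j is a holomorphic automorphism of C^2,
   with inverse trans j i p, is a consequence. *)
Record bundle (B : set S) := Bundle {
  base_open : open B;
  total :> Type;
  proj : total -> S;
  proj_base : forall e, B (proj e);
  index : Type;
  dom : index -> set S;
  dom_open : forall i, open (dom i);
  dom_cover : \bigcup_i dom i = B;
  coord : index -> total -> C2 R;
  coord_bij : forall i, set_bij (proj @^-1` dom i) (dom i `*` setT)
                          (fun e => (proj e, coord i e));
  trans : index -> index -> S -> C2 R -> C2 R;
  transE : forall i j e, dom i (proj e) -> dom j (proj e) ->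
    coord i e = trans i j (proj e) (coord j e);
  trans_hol : forall i j, hol_over (dom i `&` dom j) (trans i j)
}.

Section Restriction.
Variables (L B : set S) (oL : open L) (sub : L `<=` B) (Y : bundle B).

Let total' := {e : Y | L (proj e)}.
Let proj' (e : total') := proj (sval e).
Let dom' (i : index Y) := dom i `&` L.
Let coord' (i : index Y) (e : total') := coord i (sval e).

Let proj_base' e : L (proj' e).
Proof. exact: (svalP e). Qed.

Let dom_open' i : open (dom' i).
Proof. by apply: openI => //; exact: dom_open. Qed.

Let dom_cover' : \bigcup_i dom' i = L.
Proof.
rewrite /dom' -setI_bigcupl dom_cover; apply/seteqP; split => [p []//|p Lp].
by split=> //; exact: sub.
Qed.

Let coord_bij' i : set_bij (proj' @^-1` dom' i) (dom' i `*` setT)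
                     (fun e => (proj' e, coord' i e)).
Proof.
have [_ inj surj] := coord_bij i; split => [e /= De|e1 e2|[p z] /= [[Dp Lp] _]].
- by split.
- rewrite !inE /= => -[D1 _] [D2 _] eq12; apply: eq_sig_hprop => [x|]; first exact: Prop_irrelevance.
  by apply: inj; rewrite ?inE.
- have [|e De [ep ez]] := surj (p, z); first by split.
  have Le : L (proj e) by rewrite ep.
  by exists (exist _ e Le) => //=; rewrite /proj' /coord' /= ep ez.
Qed.

Let transE' i j e : dom' i (proj' e) -> dom' j (proj' e) ->
  coord' i e = trans i j (proj' e) (coord' j e).
Proof. by move=> [Di _] [Dj _]; exact: transE. Qed.

Let trans_hol' i j : hol_over (dom' i `&` dom' j) (@trans _ Y i j).
Proof. by move=> p z [[Di _] [Dj _]]; exact: trans_hol. Qed.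

Definition restriction : bundle L :=
  Bundle oL proj_base' dom_open' dom_cover' coord_bij' transE' trans_hol'.

End Restriction.

(* F is meant to cover the identity of the base. *)
Definition hol_bundle_map (L L' : set S) (X : bundle L) (Y : bundle L')
    (F : X -> Y) : Prop :=
  forall (i : index X) (j : index Y), exists h,
    hol_over (dom i `&` dom j) h /\
    forall e, dom i (proj e) -> dom j (proj (F e)) ->
      coord j (F e) = h (proj e) (coord i e).

Definition isomorphic (L : set S) (X Y : bundle L) : Prop :=
  exists (F : X -> Y) (G : Y -> X),
    [/\ cancel F G, cancel G F, forall e, proj (F e) = proj e,
        hol_bundle_map F & hol_bundle_map G].

Definition is_extension (L B : set S) (X : bundle L) (Y : bundle B) : Prop :=
  exists sub : L `<=` B, isomorphic X (restriction (base_open X) sub Y).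

Definition extends_to (L : set S) (X : bundle L) (B : set S) : Prop :=
  exists Y : bundle B, is_extension X Y.

(* e |-> (proj e, s e) is a holomorphic trivialization of X over U; the values
   of s outside the part of X over U are irrelevant. *)
Definition trivialization (L : set S) (X : bundle L) (U : set S)
    (s : X -> C2 R) : Prop :=
  [/\ open U,
      set_bij (@proj _ X @^-1` U) (U `*` setT) (fun e => (proj e, s e)) &
      forall i : index X, exists g h,
        [/\ hol_over (U `&` dom i) g, hol_over (U `&` dom i) h &
            forall e, U (proj e) -> dom i (proj e) ->
              s e = g (proj e) (coord i e) /\ coord i e = h (proj e) (s e)]].

End Bundles.

Section Gluing.
Variable R : realType.
Local Notation C := (Cplx R).

Definition arg_branch (c : C) (A : set C) (theta : C -> R) : Prop :=
  {within A, continuous theta} /\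
  forall z, A z -> z - c = `|z - c| * (cos (theta z) +i* sin (theta z))%C.

(* X is obtained from the trivial bundle over L cut along the g j, with fiber
   coordinate tau, by gluing the two sides of g j by f j when g j is crossed
   counterclockwise around c j. The sides are told apart by the argument of
   z - c j: its branch theta j on the cut domain drops by 2 pi with respect to
   a continuous branch alpha near a point of g j when g j is crossed
   counterclockwise. Thus, near such a point, X has a trivialization sigma equal
   to tau before the crossing and such that tau is f j of sigma after it. *)
Definition glued_bundle (n : nat) (L : set C) (c : 'I_n -> C)
    (g : 'I_n -> set C) (f : 'I_n -> C2 R -> C2 R)
    (X : bundle (Some @` L : set (sphere R))) : Prop :=
  let cut := L `\` \bigcup_j g j in
  exists (tau : X -> C2 R) (theta : 'I_n -> C -> R),
  [/\ trivialization (Some @` cut) tau,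
      forall j, arg_branch (c j) cut (theta j) &
      forall j p, L p -> g j p ->
        exists (U : set C) (alpha : C -> R) (sigma : X -> C2 R),
        [/\ open U, U p, arg_branch (c j) U alpha,
            trivialization (Some @` U) sigma &
            forall e z, proj e = Some z -> U z -> cut z ->
              (theta j z = alpha z /\ tau e = sigma e) \/
              (theta j z = alpha z - 2 * pi /\ tau e = f j (sigma e))]].

Definition unit_disc : set C := [set z | `|z| < 1].
Definition closed_disc (c : C) (r : R) : set C := [set z | `|z - c| <= r%:C%C].
Definition circle (c : C) (r : R) : set C := [set z | `|z - c| = r%:C%C].

Definition holed_disc (n : nat) (c : 'I_n -> C) (rho : 'I_n -> R) : set C :=
  unit_disc `\` \bigcup_j closed_disc (c j) (rho j).

Definition annulus (r1 r2 : R) : set C :=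
  [set z | r1%:C%C < `|z| < r2%:C%C].

(* g is an arc, endpoints included, joining A to B inside L. *)
Definition joining_arc (L A B g : set C) : Prop :=
  exists k : R -> C,
    [/\ {within `[0, 1], continuous k}, set_inj `[0, 1] k, g = k @` `[0, 1],
        A (k 0) /\ B (k 1) & forall t, 0 < t < 1 -> L (k t)].

Definition simply_connected (A : set C) : Prop :=
  (forall a b, A a -> A b -> exists k : R -> C,
    [/\ {within `[0, 1], continuous k}, k @` `[0, 1] `<=` A,
        k 0 = a & k 1 = b]) /\
  (forall k : R -> C,
    {within `[0, 1], continuous k} -> k @` `[0, 1] `<=` A -> k 0 = k 1 ->
    exists H : R * R -> C,
    [/\ {within `[0, 1] `*` `[0, 1], continuous H},
        H @` (`[0, 1] `*` `[0, 1]) `<=` A,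
        forall t, 0 <= t <= 1 -> H (0, t) = k t,
        forall s, 0 <= s <= 1 -> H (s, 0) = H (s, 1) &
        forall t, 0 <= t <= 1 -> H (1, t) = H (1, 0)]).

Definition slit_holed_disc (n : nat) (c : 'I_n -> C) (rho : 'I_n -> R)
    (g : 'I_n -> set C) : Prop :=
  [/\ forall j, 0 < rho j /\ closed_disc (c j) (rho j) `<=` unit_disc,
      trivIset setT (fun j => closed_disc (c j) (rho j)),
      forall j, joining_arc (holed_disc c rho)
                  (circle (c j) (rho j)) (circle 0 1) (g j),
      trivIset setT g &
      simply_connected (holed_disc c rho `\` \bigcup_j g j)].

(* The bundle over the holed disc defined by the gluing automorphism f j around
   the j-th hole, for some choice of the arcs. *)
Definition bundle_of_holes (n : nat) (c : 'I_n -> C) (rho : 'I_n -> R)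
    (f : 'I_n -> C2 R -> C2 R)
    (X : bundle (Some @` holed_disc c rho : set (sphere R))) : Prop :=
  exists g : 'I_n -> set C, slit_holed_disc c rho g /\ glued_bundle c g f X.

(* The bundle over the annulus defined by the gluing automorphism f, the cut
   being the radius through some u of modulus 1. *)
Definition bundle_of_annulus (r1 r2 : R) (f : C2 R -> C2 R)
    (X : bundle (Some @` annulus r1 r2 : set (sphere R))) : Prop :=
  exists u : C, `|u| = 1 /\
    glued_bundle (fun _ : 'I_1 => 0)
      (fun _ => [set t%:C%C * u | t in `]r1, r2[]) (fun _ => f) X.

End Gluing.

Section Automorphisms.
Variable R : realType.
Local Notation C := (Cplx R).

Definition overshear (f : C2 R -> C2 R) : Prop :=
  exists Q : C -> C, entire Q /\
    ((forall z, f z = (z.1, z.2 * cexp (Q z.1))) \/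
     (forall z, f z = (z.1 * cexp (Q z.2), z.2))).

Definition skoda_shear (z : C2 R) : C2 R := (z.1, z.2 * cexp z.1).

Definition skoda_rotation (z : C2 R) : C2 R := ('i%C * z.2, z.1).

Definition henon (k : nat) (z : C2 R) : C2 R := (z.2, - z.1 + z.2 ^+ k).

(* The inner variable of P : {poly {poly C}} is z.1, the outer one z.2. *)
Definition polynomial_map (f : C2 R -> C2 R) : Prop :=
  exists P Q : {poly {poly R[i]}},
    forall z : C2 R, f z = (P.[(z.2)%:P].[z.1], Q.[(z.2)%:P].[z.1]).

Definition polynomial_automorphism (f : C2 R -> C2 R) : Prop :=
  polynomial_map f /\
  exists f', [/\ polynomial_map f', cancel f f' & cancel f' f].

Definition polynomial_gluing (B : set (sphere R)) (Y : bundle B) : Prop :=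
  forall (i j : index Y) p, dom i p -> dom j p ->
    polynomial_automorphism (trans i j p).

End Automorphisms.

(* Main.v *)
From mathcomp Require Import all_boot all_order all_algebra.
From mathcomp Require Import complex ring lra.
From mathcomp Require Import all_classical all_reals all_analysis.
Require Import Defs.

Set Implicit Arguments.
Unset Strict Implicit.
Unset Printing Implicit Defensive.

Import Order.TTheory GRing.Theory Num.Theory.
Import numFieldNormedType.Exports.

Local Open Scope classical_set_scope.
Local Open Scope ring_scope.

(** A holomorphic automorphism of C^2 that is the time-one map phi 1 of a
    holomorphic action phi of C on C^2 can be unwound: if a fiber coordinate tau
    is glued by phi 1 around c, then phi (log (z - c) / (2 pi i)) tau has no jump.
    Over-shears and the linear map (z1, z2) |-> (i z2, z1) are such time-one maps
    ([overshear_flow], [antidiagonal_flow]), and so are the two factors of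
    (z1, z2) |-> (z2, - z1 + z2 ^ k), a rotation followed by a shear.

    To reach the whole sphere, z - c is replaced by (z - a) / (z - b), with b on
    the far side of the base: it has a holomorphic logarithm, infinity included,
    off any path from a to b ([path_log], by lifting paths through the
    exponential). Given disjoint compact cuts K j with flows phi j and functions
    l j holomorphic off K j, [flow_bundle] is a bundle over the sphere with one
    chart for each j, defined off the other cuts: off all the cuts, the j-th
    coordinate is phi j (l j) tau. A bundle X trivialized by tau off the cuts
    embeds into it as soon as each phi j (l j) tau extends across K j in X
    ([flow_bundle_charts]). The extension is a local matter, and it is unique,
    because an arc has no interior ([triv_extend], [arc_dense]). It exists
    because l j differs from the logarithm given by the argument that defines the
    gluing by a function holomorphic across the cut ([slit_log], where the
    connectedness of the cut base is used), and because this argument drops by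
    2 pi exactly where tau jumps by phi j 1 ([flow_crossing]).

    Over the holed disc, K j is the j-th closed disc together with its arc
    ([bundle_of_holes_extends]). Over the annulus, a change of coordinate on one
    half of the base moves the shear to the radius opposite to that of the
    rotation, so that two opposite slits carry one flow each
    ([bundle_of_annulus_extends]). Both flows act by polynomial automorphisms, so
    the transition maps, which are products of their elements, are polynomial
    ([henon_extends]). *)

(** * The complex plane, measured by real radii *)

Section ComplexTopology.
Variable R : realType.
Local Notation C := (Cplx R).
Local Notation Re := (@complex.Re _).
Local Notation Im := (@complex.Im _).

Lemma ReD (x y : C) : Re (x + y) = Re x + Re y.
Proof. by case: x y => [a b] [c d]. Qed.

Lemma ImD (x y : C) : Im (x + y) = Im x + Im y.
Proof. by case: x y => [a b] [c d]. Qed.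

Lemma ReN (x : C) : Re (- x) = - Re x.
Proof. by case: x. Qed.

Lemma ImN (x : C) : Im (- x) = - Im x.
Proof. by case: x. Qed.

Lemma ReM (x y : C) : Re (x * y) = Re x * Re y - Im x * Im y.
Proof. by case: x y => [a b] [c d]. Qed.

Lemma ImM (x y : C) : Im (x * y) = Re x * Im y + Im x * Re y.
Proof. by case: x y => [a b] [c d]. Qed.

Lemma complex_eq (x y : C) : Re x = Re y -> Im x = Im y -> x = y.
Proof. by case: x y => [a b] [c d] /= -> ->. Qed.

Definition cabs (z : C) : R := Re `|z|.

Lemma normE (z : C) : `|z| = (cabs z)%:C%C.
Proof. by rewrite /cabs normc_def. Qed.

Lemma cabs_ge0 z : 0 <= cabs z.
Proof. by rewrite -lecR -normE normr_ge0. Qed.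

Lemma sqr_cabs z : cabs z ^+ 2 = Re z ^+ 2 + Im z ^+ 2.
Proof. by rewrite /cabs normc_def /= sqr_sqrtr// addr_ge0// sqr_ge0. Qed.

Lemma cabs_gt0 z : (0 < cabs z) = (z != 0).
Proof. by rewrite -ltcR -normE normr_gt0. Qed.

Lemma cabsM z w : cabs (z * w) = cabs z * cabs w.
Proof. by apply: complexI; rewrite -normE normrM !normE rmorphM. Qed.

Lemma cabsV z : cabs z^-1 = (cabs z)^-1.
Proof. by apply: complexI; rewrite -normE normfV normE fmorphV. Qed.

Lemma cabsN z : cabs (- z) = cabs z.
Proof. by rewrite /cabs normrN. Qed.

Lemma cabsR (r : R) : cabs (r%:C)%C = `|r|.
Proof. by rewrite /cabs normc_def /= expr0n /= addr0 sqrtr_sqr. Qed.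

Lemma cabsD z w : cabs (z + w) <= cabs z + cabs w.
Proof. by rewrite -lecR rmorphD /= -!normE ler_normD. Qed.

Lemma Re_le_cabs z : `|Re z| <= cabs z.
Proof. by rewrite -lecR -normE normc_ge_Re. Qed.

Lemma Im_le_cabs z : `|Im z| <= cabs z.
Proof.
rewrite -(@ler_pXn2r _ 2)// ?nnegrE ?cabs_ge0// sqr_cabs -normrX ger0_norm ?sqr_ge0//.
by rewrite lerDr sqr_ge0.
Qed.

Lemma cabs_le z : cabs z <= `|Re z| + `|Im z|.
Proof.
rewrite -(@ler_pXn2r _ 2)// ?nnegrE ?cabs_ge0 ?addr_ge0//.
rewrite sqr_cabs sqrrD !real_normK ?num_real// lerD2r lerDl.
by rewrite mulrn_wge0// mulr_ge0.
Qed.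

Lemma pos_complexE (e : C) : 0 < e -> e = (Re e)%:C%C /\ 0 < Re e.
Proof. by case: e => a b; rewrite ltcE /= => /andP[/eqP -> ->]. Qed.

Lemma cvg_cabsP (T : Type) (F : set_system T) {FF : Filter F} (f : T -> C)
    (a : C) :
  (f @ F --> a) <->
  (forall e : R, 0 < e -> \forall x \near F, cabs (a - f x) < e).
Proof.
split=> [/cvgrPdist_lt h e e0|h].
  have /h : 0 < e%:C%C :> C by rewrite ltcR.
  by apply: filterS => x; rewrite normE ltcR.
apply/cvgrPdist_lt => e /pos_complexE[-> /h].
by apply: filterS => x; rewrite normE ltcR.
Qed.

Lemma cvg_complexP (T : Type) (F : set_system T) {FF : Filter F} (f : T -> C)
    (a : C) :
  (f @ F --> a) <->
  (Re (f x) @[x --> F] --> Re a /\ Im (f x) @[x --> F] --> Im a).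
Proof.
split=> [/cvg_cabsP h|[/cvgrPdist_lt h1 /cvgrPdist_lt h2]].
  split; apply/cvgrPdist_lt => e /h; apply: filterS => x; apply: le_lt_trans.
    by rewrite -ReN -ReD Re_le_cabs.
  by rewrite -ImN -ImD Im_le_cabs.
apply/cvg_cabsP => e e0; have e20 : 0 < e / 2 by rewrite divr_gt0.
move: (h1 _ e20) (h2 _ e20); apply: filterS2 => x l1 l2.
rewrite (le_lt_trans (cabs_le _))// ReD ImD ReN ImN (splitr e).
exact: ltrD.
Qed.

Lemma nbhs_cabsP (p : C) (A : set C) :
  nbhs p A <-> exists e : R, 0 < e /\ forall z, cabs (z - p) < e -> A z.
Proof.
split=> [/nbhs_ballP[e /pos_complexE[-> e0] h]|[e [e0 h]]].
  exists (Re e); split=> // z lz; apply: h.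
  by rewrite -ball_normE /= distrC normE ltcR.
apply/nbhs_ballP; exists e%:C%C; first by rewrite /= ltcR.
by move=> z; rewrite -ball_normE /= distrC normE ltcR; exact: h.
Qed.

Lemma cvg_planeP (f : C -> C) (p a : C) : (f @ p --> a) <->
  (forall e : R, 0 < e ->
     exists d : R, 0 < d /\ forall z, cabs (z - p) < d -> cabs (f z - a) < e).
Proof.
split=> [/cvg_cabsP h e /h/nbhs_cabsP[d [d0 hd]]|h].
  by exists d; split=> // z /hd; rewrite -opprB cabsN.
apply/(cvg_cabsP (F := nbhs p)) => e /h[d [d0 hd]]; apply/nbhs_cabsP.
by exists d; split=> // z /hd; rewrite -opprB cabsN.
Qed.

Lemma continuous_Re : continuous (fun z : C => Re z).
Proof. by move=> z; have [] := (cvg_complexP (F := nbhs z) (@id C) z).1 cvg_id. Qed.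

Lemma continuous_Im : continuous (fun z : C => Im z).
Proof. by move=> z; have [] := (cvg_complexP (F := nbhs z) (@id C) z).1 cvg_id. Qed.

Lemma continuous_cabs : continuous cabs.
Proof.
move=> z; apply: (continuous_comp (f := fun x : C => `|x| : C) (g := fun x : C => Re x)).
  exact: norm_continuous.
exact: continuous_Re.
Qed.

Lemma continuous_real_complex : continuous (fun t : R => t%:C%C : C).
Proof. by move=> t; apply/cvg_complexP; split=> /=; [exact: cvg_id | exact: cvg_cst]. Qed.

Section Arithmetic.
Variables (T : Type) (F : set_system T).
Context {FF : Filter F}.
Implicit Types (f g : T -> C) (a b : C).

Lemma ccvgM f g a b : f @ F --> a -> g @ F --> b ->
  (fun x => f x * g x : C) @ F --> (a * b : C).
Proof. move=> fa gb; exact (@cvgM _ _ _ FF _ _ _ _ fa gb). Qed.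

Lemma ccvgD f g a b : f @ F --> a -> g @ F --> b ->
  (fun x => f x + g x : C) @ F --> (a + b : C).
Proof. move=> fa gb; exact (@cvgD _ _ _ _ FF _ _ _ _ fa gb). Qed.

Lemma ccvgN f a : f @ F --> a -> (fun x => - f x : C) @ F --> (- a : C).
Proof. move=> fa; exact (@cvgN _ _ _ _ FF _ _ fa). Qed.

Lemma ccvgB f g a b : f @ F --> a -> g @ F --> b ->
  (fun x => f x - g x : C) @ F --> (a - b : C).
Proof. by move=> fa gb; apply: ccvgD; [exact: fa|apply: ccvgN; exact: gb]. Qed.

Lemma ccvgV f a : a != 0 -> f @ F --> a ->
  (fun x => (f x)^-1 : C) @ F --> (a^-1 : C).
Proof. move=> a0 fa; exact (@cvgV _ _ _ FF _ _ a0 fa). Qed.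

Lemma ccvg_cst a : (fun _ : T => a) @ F --> a.
Proof. exact: cvg_cst. Qed.

End Arithmetic.

End ComplexTopology.

(** * The complex exponential *)

Section Exponential.
Variable R : realType.
Local Notation C := (Cplx R).
Local Notation Re := (@complex.Re _).
Local Notation Im := (@complex.Im _).
Local Notation cexp := (@cexp R).

Lemma cexp0 : cexp 0 = 1.
Proof. by apply: complex_eq; rewrite /= ?expR0 ?cos0 ?sin0 ?mulr1 ?mulr0. Qed.

Lemma cexpD z w : cexp (z + w) = cexp z * cexp w.
Proof.
by apply: complex_eq; rewrite ?ReM ?ImM /= ReD ImD expRD ?cosD ?sinD; ring.
Qed.

Lemma cexp_neq0 z : cexp z != 0.
Proof.
apply/eqP => z0; have := cexpD z (- z).
by rewrite subrr cexp0 z0 mul0r => /eqP; rewrite oner_eq0.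
Qed.

Lemma cexpN z : cexp (- z) = (cexp z)^-1.
Proof.
apply: (mulfI (cexp_neq0 z)).
by rewrite -cexpD subrr cexp0 divff// cexp_neq0.
Qed.

Lemma cexpB z w : cexp (z - w) = cexp z / cexp w.
Proof. by rewrite cexpD cexpN. Qed.

Lemma cabs_cexp z : cabs (cexp z) = expR (Re z).
Proof.
apply/eqP; rewrite -(@eqrXn2 _ 2)// ?cabs_ge0 ?expR_ge0// sqr_cabs /=.
by rewrite !exprMn -mulrDr cos2Dsin2 mulr1.
Qed.

Lemma cexp_eq z w : cexp z = cexp w ->
  Re z = Re w /\ cos (Im z - Im w) = 1.
Proof.
move=> e; have e1 : cexp (z - w) = 1 by rewrite cexpB e divff// cexp_neq0.
have eR : Re (z - w) = 0.
  by apply: expR_inj; rewrite -cabs_cexp e1 expR0 /cabs normr1.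
split; first by apply/eqP; rewrite -subr_eq0 -ReN -ReD eR.
by have /(congr1 Re) := e1; rewrite /= eR expR0 mul1r ImD ImN.
Qed.

Let derive_bound (f : R -> R) (df : R) : is_derive (0 : R) 1 f df ->
  forall e, 0 < e -> \forall h \near (0 : R), `|f h - f 0 - df * h| <= e * `|h|.
Proof.
move=> [fd fE] e e0; have := fd; rewrite /derivable => /cvg_ex[l lE].
have ldf : l = df.
  by rewrite -fE; apply/esym/cvg_lim.
move: lE; rewrite ldf => /cvgrPdist_le/(_ e e0).
rewrite near_withinE; apply: filterS => h /= hE.
have [->|h0] := eqVneq h 0; first by rewrite subrr mulr0 subr0 normr0 mulr0.
have := hE h0; rewrite addr0 /GRing.scale /= mulr1 => b.
rewrite -subr_ge0.
have -> : f h - f 0 - df * h = - (df - h^-1 * (f h - f 0)) * h by field.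
by rewrite normrM normrN subr_ge0 ler_wpM2r.
Qed.

(** The difference quotient of the exponential at the origin, from the
    first-order expansions of the real exponential, cosine and sine. *)
Lemma cexp_slope : h^-1 * (cexp h - 1) @[h --> (0 : C)^'] --> (1 : C).
Proof.
have dE := derive_bound (is_derive_expR (0 : R)).
have dC := derive_bound (is_derive_cos (0 : R)).
have dS := derive_bound (is_derive_sin (0 : R)).
have Re0 : Re (h : C) @[h --> (0 : C)] --> (0 : R) by have := @continuous_Re R (0 : C).
have Im0 : Im (h : C) @[h --> (0 : C)] --> (0 : R) by have := @continuous_Im R (0 : C).
apply/cvg_cabsP => e e0.
have e6 : 0 < e / 8 by rewrite divr_gt0.
rewrite near_withinE.
have n1 := Re0 _ (dE _ e6).
have n2 := Im0 _ (dC _ e6).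
have n3 := Im0 _ (dS _ e6).
have n4 : \forall h \near (0 : R), `|expR h - 1| < Num.min 1 (e / 8).
  have /cvgrPdist_lt : expR h @[h --> (0 : R)] --> expR 0 by exact: continuous_expR.
  move/(_ (Num.min 1 (e / 8))); rewrite lt_min ltr01 e6 => /(_ isT).
  by apply: filterS => h; rewrite expR0 distrC.
have {}n4 := Re0 _ n4.
move: n1 n2 n3 n4; rewrite /fmap /= !nbhs_simpl /= => n1 n2 n3 n4.
near=> h => h0.
have b1 : `|expR (Re h) - expR 0 - expR 0 * Re h| <= e / 8 * `|Re h|.
  by near: h; exact: n1.
have b2 : `|cos (Im h) - cos 0 - (- sin 0) * Im h| <= e / 8 * `|Im h|.
  by near: h; exact: n2.
have b3 : `|sin (Im h) - sin 0 - cos 0 * Im h| <= e / 8 * `|Im h|.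
  by near: h; exact: n3.
have b4 : `|expR (Re h) - 1| < Num.min 1 (e / 8) by near: h; exact: n4.
move: b4 b3 b2 b1.
rewrite lt_min expR0 cos0 sin0 oppr0 mul0r !addr0 !subr0 !mul1r.
move=> /andP[b1 b2] b3 b4 b5.
have := Re_le_cabs h; have := Im_le_cabs h.
have hp : 0 < cabs h by rewrite cabs_gt0.
set x := Re h in b1 b2 b3 b4 b5 *; set y := Im h in b1 b2 b3 b4 b5 *.
move=> yh xh.
have E2 : `|expR x| <= 2.
  by rewrite -(subrK 1 (expR x)) (le_trans (ler_normD _ _))// normr1 lerD2r ltW.
have -> : 1 - h^-1 * (cexp h - 1) = - ((cexp h - 1 - h) / h) by field.
rewrite cabsN cabsM cabsV ltr_pdivrMr// (le_lt_trans (cabs_le _))//.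
rewrite !ReD !ImD !ReN !ImN /= -/x -/y.
have -> : expR x * cos y - 1 - x = (expR x - 1 - x) + expR x * (cos y - 1) by ring.
have -> : expR x * sin y - 0 - y = expR x * (sin y - y) + (expR x - 1) * y by ring.
have h1 : `|expR x * (cos y - 1)| <= 2 * (e / 8 * cabs h).
  rewrite normrM; apply: ler_pM => //.
  by apply: le_trans b4 _; rewrite ler_wpM2l// ltW.
have h2 : `|expR x * (sin y - y)| <= 2 * (e / 8 * cabs h).
  rewrite normrM; apply: ler_pM => //.
  by apply: le_trans b3 _; rewrite ler_wpM2l// ltW.
have h3 : `|(expR x - 1) * y| <= e / 8 * cabs h.
  by rewrite normrM; apply: ler_pM => //; exact: ltW.
have h4 : `|expR x - 1 - x| <= e / 8 * cabs h.
  by apply: le_trans b5 _; rewrite ler_wpM2l// ltW.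
have := ler_normD (expR x - 1 - x) (expR x * (cos y - 1)).
have := ler_normD (expR x * (sin y - y)) ((expR x - 1) * y).
have := mulr_gt0 e0 hp.
lra.
Unshelve. all: by end_near. Qed.

Lemma differentiable_cexp z : differentiable cexp z.
Proof.
apply/derivable1_diffP; rewrite /derivable; apply/cvg_ex; exists (cexp z).
rewrite -[X in _ --> X]mulr1.
have -> : (fun h : C => h^-1 *: (cexp (h *: (1 : C) + z) - cexp z)) =
    (fun h => cexp z * (h^-1 * (cexp h - 1))).
  by apply/funext => h; rewrite /GRing.scale /= mulr1 cexpD; ring.
exact: cvgM (cvg_cst _) cexp_slope.
Qed.

Let cexp_quot (d : C) : C := if d == 0 then 1 else d^-1 * (cexp d - 1).

Let cexp_quot_cvg : cexp_quot d @[d --> (0 : C)] --> (1 : C).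
Proof.
apply/(cvg_cabsP (F := nbhs (0 : C))) => e e0.
have /cvg_cabsP/(_ e e0) := cexp_slope; rewrite near_withinE.
apply: filterS => d h; rewrite /cexp_quot; case: eqVneq => [_|/h//].
by rewrite subrr /cabs normr0.
Qed.

Let cvg_quot (F : set_system C) {FF : Filter F} (a p : C -> C) (c l : C) :
  a @ F --> l -> p @ F --> (1 : C) ->
  (fun h => a h / c * (p h)^-1 : C) @ F --> (l / c : C).
Proof.
move=> ha hp; have e : l / c = l / c / 1 by rewrite invr1 mulr1.
rewrite e; apply: ccvgM; last by apply: ccvgV; [exact: oner_neq0|exact: hp].
by apply: ccvgM; [exact: ha|exact: ccvg_cst].
Qed.

(** A continuous logarithm of a holomorphic function is holomorphic: its
    increments d satisfy d * ((cexp d - 1) / d) = g (z + h) / g z - 1. *)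
Lemma differentiable_log (L g : C -> C) z : {for z, continuous L} ->
  (\forall w \near z, cexp (L w) = g w) -> differentiable g z ->
  differentiable L z.
Proof.
move=> cL Lg dg; have gz := nbhs_singleton Lg.
pose dl : C -> C := fun h => L (h + z) - L z.
have shz : (fun h : C => (h + z : C)) @ (0 : C) --> z.
  apply/cvg_planeP => e e0; exists e; split=> // w.
  by rewrite subr0 addrK.
have dl0 : dl @ (0 : C) --> (0 : C).
  apply/cvg_planeP => e e0; have /cvg_planeP/(_ _ e0)[d [d0 hd]] := cL.
  exists d; split=> // w; rewrite !subr0 => lw; apply: hd.
  by rewrite addrK.
have pd : cexp_quot (dl h) @[h --> (0 : C)] --> (1 : C) by exact: cvg_comp dl0 cexp_quot_cvg.
have pn0 : \forall h \near (0 : C), cexp_quot (dl h) != 0.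
  have /cvg_cabsP/(_ _ ltr01) := pd; apply: filterS => h.
  by apply: contraTneq => ->; rewrite subr0 /cabs normr1 ltxx.
move/derivable1_diffP: dg; rewrite /derivable => /cvg_ex[/= g' dg].
apply/derivable1_diffP/cvg_ex; exists (g' / g z).
have gz0 : g z != 0 by rewrite -gz cexp_neq0.
have pd' : cexp_quot \o dl @ (0 : C)^' --> (1 : C) by exact: cvg_within_filter pd.
have lim := @cvg_quot _ _ _ _ (g z) _ dg pd'.
apply: cvg_trans (lim _); apply: near_eq_cvg.
have Lgh : \forall h \near (0 : C), cexp (L (h + z)) = g (h + z) by exact: (shz _ Lg).
rewrite near_withinE; near=> h => h0.
have e1 : cexp (L (h + z)) = g (h + z) by near: h.
have e2 : cexp_quot (dl h) != 0 by near: h.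
rewrite /GRing.scale /= mulr1.
have e3 : g (h + z) = g z + g z * (dl h * cexp_quot (dl h)).
  have -> : dl h * cexp_quot (dl h) = cexp (dl h) - 1.
    rewrite /cexp_quot; case: eqVneq => [->|d0]; first by rewrite cexp0 subrr mul0r.
    by rewrite mulrA divff// mul1r.
  by rewrite /dl cexpB e1 gz; field.
by rewrite e3 -/(dl h); field; rewrite gz0 h0 e2.
Unshelve. all: by end_near. Qed.

End Exponential.

(** * Holomorphic functions *)

Section Differentiability.
Variable R : realType.
Local Notation C := (Cplx R).

Lemma cdiff_id (x : C) : differentiable (fun y : C => y) x.
Proof. exact: ex_diff. Qed.

Lemma diff_fst (U W : normedModType R[i]) (x : U * W) :
  differentiable (fun y : U * W => y.1) x.
Proof.
by apply: (@linear_differentiable R[i] (U * W)%type U (@fst U W) x) => y;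
  exact: cvg_fst.
Qed.

Lemma diff_snd (U W : normedModType R[i]) (x : U * W) :
  differentiable (fun y : U * W => y.2) x.
Proof.
by apply: (@linear_differentiable R[i] (U * W)%type W (@snd U W) x) => y;
  exact: cvg_snd.
Qed.

Lemma diff_pair (U W W' : normedModType R[i]) (f : U -> W) (g : U -> W') x :
  differentiable f x -> differentiable g x ->
  differentiable (fun y => (f y, g y)) x.
Proof. exact: differentiable_pair. Qed.

Section Arithmetic.
Context {V : normedModType R[i]}.
Implicit Types (f g : V -> C).

Lemma cdiffD f g x : differentiable f x -> differentiable g x ->
  differentiable (fun y => f y + g y : C) x.
Proof. exact: differentiableD. Qed.

Lemma cdiffN f x : differentiable f x -> differentiable (fun y => - f y : C) x.
Proof. exact: differentiableN. Qed.

Lemma cdiffB f g x : differentiable f x -> differentiable g x ->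
  differentiable (fun y => f y - g y : C) x.
Proof. exact: differentiableB. Qed.

Lemma cdiffM f g x : differentiable f x -> differentiable g x ->
  differentiable (fun y => f y * g y : C) x.
Proof. exact: differentiableM. Qed.

Lemma cdiffV f x : differentiable f x -> f x != 0 ->
  differentiable (fun y => (f y)^-1 : C) x.
Proof. exact: differentiableV. Qed.

Lemma cdiff_cst (a : C) x : differentiable (fun _ : V => a) x.
Proof. exact: differentiable_cst. Qed.

Lemma cdiffX f n x : differentiable f x ->
  differentiable (fun y => f y ^+ n : C) x.
Proof.
move=> df; elim: n => [|n IH]; first exact: differentiable_cst.
have -> : (fun y => f y ^+ n.+1 : C) = (fun y => f y * f y ^+ n : C).
  by apply/funext => y; rewrite exprS.
exact: cdiffM.
Qed.

Lemma cdiff_comp f (g : C -> C) x : differentiable f x ->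
  differentiable g (f x) -> differentiable (fun y => g (f y) : C) x.
Proof. exact: differentiable_comp. Qed.

Lemma cdiff_exp f x : differentiable f x ->
  differentiable (fun y => cexp (f y) : C) x.
Proof. by move=> df; apply: cdiff_comp => //; exact: differentiable_cexp. Qed.

End Arithmetic.

Lemma differentiable_near (U W : normedModType R[i]) (f g : U -> W) x :
  (\forall y \near x, f y = g y) -> differentiable g x -> differentiable f x.
Proof.
move=> fg dg; have fgx := nbhs_singleton fg.
have [cdg /eqaddoP dgE] := (diff_locallyP _ _).1 dg.
have dfE : f \o shift x = cst (f x) + 'd g x +o_ 0 id.
  apply/eqaddoP => e e0.
  have sh : \forall h \near (0 : U), f (h + x) = g (h + x).
    have sc : h + x @[h --> (0 : U)] --> 0 + x.
      by apply: cvgD; [exact: cvg_id|exact: cvg_cst].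
    by rewrite add0r in sc; exact: (sc _ fg).
  near=> h. 
  have <- : (g \o shift x - (cst (g x) + 'd g x)) h = (f \o shift x - (cst (f x) + 'd g x)) h.
    have e1 : f (h + x) = g (h + x) by near: h.
    by rewrite /= !fctE /= e1 fgx.
  by near: h; exact: dgE.
by apply/diff_locallyP; rewrite (diff_unique cdg dfE).
Unshelve. all: by end_near. Qed.

End Differentiability.

(** * Logarithms along paths *)

Section Logarithm.
Variable R : realType.
Local Notation C := (Cplx R).
Local Notation Re := (@complex.Re _).
Local Notation Im := (@complex.Im _).
Local Notation cexp := (@cexp R).

Definition clog (w : C) : C := (ln (cabs w) +i* atan (Im w / Re w))%C.

Lemma cexp_clog (w : C) : 0 < Re w -> cexp (clog w) = w.
Proof.
move=> w0; have wn0 : w != 0 by apply: contraTneq w0 => ->; rewrite ltxx.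
set t := Im w / Re w; have Imw : Im w = t * Re w by rewrite /t divfK// gt_eqF.
have d0 : 0 < Num.sqrt (1 + t ^+ 2) by rewrite sqrtr_gt0 ltr_pwDl// sqr_ge0.
have ct : cabs w * cos (atan t) = Re w.
  rewrite cos_atan; apply: (canLR (mulfK _)); first by rewrite gt_eqF.
  apply/eqP; rewrite -(@eqrXn2 _ 2)// ?cabs_ge0 ?mulr_ge0 ?ltW//.
  rewrite sqr_cabs exprMn sqr_sqrtr ?addr_ge0 ?sqr_ge0// Imw; apply/eqP; ring.
have st : cabs w * sin (atan t) = Im w.
  have c0 : cos (atan t) != 0 by rewrite cos_atan invr_eq0 gt_eqF.
  have -> : sin (atan t) = t * cos (atan t).
    by rewrite -{2}(atanK t) /tan divfK.
  by rewrite mulrCA ct.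
have e : expR (ln (cabs w)) = cabs w by rewrite lnK// posrE cabs_gt0.
by apply: complex_eq; rewrite /= e.
Qed.

Lemma continuous_clog (w : C) : 0 < Re w -> {for w, continuous clog}.
Proof.
move=> w0; have wn0 : w != 0 by apply: contraTneq w0 => ->; rewrite ltxx.
apply/(cvg_complexP (F := nbhs w)); split => /=.
  apply: (continuous_comp (f := @cabs R) (g := @ln R)).
    exact: continuous_cabs.
  by apply: continuous_ln; rewrite cabs_gt0.
apply: (continuous_comp (f := fun z : C => Im z / Re z) (g := @atan R)).
  have cI : Im (z : C) @[z --> w] --> Im w by have := @continuous_Im R w.
  have cR : Re (z : C) @[z --> w] --> Re w by have := @continuous_Re R w.
  by apply: (cvgM cI (cvgV _ cR)); rewrite gt_eqF.
exact: continuous_atan.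
Qed.

Lemma Re_gt0_near1 (w : C) : cabs (w - 1) < 1 -> 0 < Re w.
Proof.
move=> /(le_lt_trans (Re_le_cabs _)); rewrite ReD ReN /= ltr_norml => /andP[+ _].
by rewrite ltrBrDr addNr.
Qed.

Lemma cos_eq1 (x : R) : cos x = 1 -> `|x| < 2 * pi -> x = 0.
Proof.
rewrite -cos_norm => c1 xpi; apply/eqP; rewrite -normr_eq0; apply: contraPT c1 => x0.
set y := `|x| / 2; have xy : `|x| = y *+ 2 by rewrite /y -mulr_natr divfK.
have : 0 < sin y.
  have nx0 : 0 < `|x| by rewrite lt0r x0 normr_ge0.
  apply: sin_gt0_pi; rewrite divr_gt0//=.
  by rewrite ltr_pdivrMr// mulrC.
rewrite xy cos_mulr2n cos2sin2 => s0.
have := exprn_gt0 2 s0; set v := sin y ^+ 2 => v0 e.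
lra.
Qed.

(** The logarithms of a given number form a discrete set. *)
Lemma log_const_segment (D : R -> C) (a b : R) (v : C) : a <= b ->
  {within `[a, b], continuous D} ->
  (forall s, a <= s <= b -> cexp (D s) = v) -> D b = D a.
Proof.
move=> ab cD Dv.
have ha : a <= a <= b by rewrite lexx.
have hb : a <= b <= b by rewrite lexx andbT.
have De s : a <= s <= b -> Re (D s) = Re (D a) /\ cos (Im (D s) - Im (D a)) = 1.
  by move=> hs; apply: cexp_eq; rewrite !Dv.
apply: complex_eq; first exact: (De b hb).1.
set f := fun s => Im (D s).
have cf : {within `[a, b], continuous f}.
  by move=> s; apply: (continuous_comp (cD s)); exact: continuous_Im.
apply: contrapT => /eqP nab; set d := f b - f a.
have dn0 : d != 0 by rewrite subr_eq0.
have p1 : 0 < 1 + `|d| by rewrite ltr_pwDl.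
(* a value between f a and f b, at positive distance less than 1 from f a *)
set v' := f a + d / (1 + `|d|).
have q1 : 0 < (1 + `|d|)^-1 <= 1.
  apply/andP; split; first by rewrite invr_gt0.
  by rewrite invf_le1// -subr_ge0 addrAC subrr add0r.
have [|s sab fs] := @IVT R f a b v' ab cf.
  have -> : f b = f a + d by rewrite /d addrC subrK.
  rewrite ge_min le_max /v'; move: q1; set q := (1 + `|d|)^-1 => /andP[q0 q1].
  rewrite !lerD2l lerDl gerDl; apply/andP.
  by case: (ltrP 0 d) => hd; split; apply/orP; [left|right|right|left]; nra.
move: sab; rewrite in_itv /= => sab.
have [_] := De s sab; rewrite -/(f s) -/(f a) fs.
rewrite /v' addrC addKr => c1.
have : d / (1 + `|d|) = 0.
  apply: cos_eq1 => //; rewrite normrM normfV (gtr0_norm p1).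
  rewrite ltr_pdivrMr//; have := pi_ge2 R; have := normr_ge0 d; nra.
by move/eqP; rewrite mulf_eq0 (negPf dn0) invr_eq0 gt_eqF.
Qed.

Definition clamp (t : R) : R := Num.max 0 (Num.min 1 t).

Lemma clamp_in t : 0 <= clamp t <= 1.
Proof. by rewrite /clamp le_max lexx /= ge_max ge_min lexx ler01. Qed.

Lemma clampK t : 0 <= t <= 1 -> clamp t = t.
Proof. by move=> /andP[t0 t1]; rewrite /clamp min_r// max_r. Qed.

Lemma continuous_clamp : continuous clamp.
Proof.
move=> t; apply: continuous_max; first exact: cvg_cst.
by apply: continuous_min; [exact: cvg_cst|exact: cvg_id].
Qed.

Lemma within_comp_continuous (T U V : topologicalType) (A : set U) (f : U -> V)
    (g : T -> U) x :
  {within A, continuous f} -> {for x, continuous g} -> (forall y, A (g y)) ->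
  {for x, continuous (f \o g)}.
Proof.
move=> /subspace_continuousP cf cg Ag B fB.
have h : within A (nbhs (g x)) (f @^-1` B) := cf _ (Ag x) _ fB.
have h' : nbhs x (g @^-1` [set y | A y -> B (f y)]) := cg _ h.
suff : nbhs x ((f \o g) @^-1` B) by [].
by apply: filterS h' => y /(_ (Ag y)).
Qed.

Lemma continuous_clamped (k : R -> C) : {within `[0, 1], continuous k} ->
  continuous (k \o clamp).
Proof.
move=> ck t; apply: (within_comp_continuous ck); first exact: continuous_clamp.
by move=> y; rewrite /= in_itv /= clamp_in.
Qed.

(** Quarter turns reduce to the domain Re z > 0 of the principal logarithm. *)
Lemma cexp_surj (z : C) : z != 0 -> exists d, cexp d = z.
Proof.
move=> z0.
have ipi2 : cexp (0 +i* (pi / 2))%C = 'i%C.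
  by apply: complex_eq; rewrite /= expR0 mul1r ?cos_pihalf ?sin_pihalf.
have half (w : C) : 0 < Re w \/ 0 < Im w -> exists d, cexp d = w.
  case=> w0; first by exists (clog w); exact: cexp_clog.
  exists ((0 +i* (pi / 2))%C + clog (- 'i%C * w)).
  rewrite cexpD ipi2 cexp_clog; last by case: (w) w0 => a b /=; lra.
  by case: (w) => a b; apply: complex_eq => /=; ring.
have [h|h] := pselect (0 < Re z \/ 0 < Im z); first exact: half.
have [|d dz] := half (- z).
  case: (z) h z0 => a b /= h; rewrite eq_complex /= negb_and => /orP[] n0.
    left; rewrite oppr_gt0 lt_neqAle n0 leNgt; apply/negP => a0; apply: h; by left.
  right; rewrite oppr_gt0 lt_neqAle n0 leNgt; apply/negP => b0; apply: h; by right.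
exists ((0 +i* (pi / 2))%C + ((0 +i* (pi / 2))%C + d)); rewrite !cexpD ipi2 dz.
by case: (z) => a b; apply: complex_eq => /=; ring.
Qed.

Lemma continuous_minr (t : R) : continuous (fun s : R => Num.min s t).
Proof.
move=> s; exact: (@continuous_min _ _ (@id R) (cst t) s (@cvg_id _ _) (cvg_cst _)).
Qed.

Lemma continuous_clip (t b : R) : continuous (fun s : R => Num.max t (Num.min s b)).
Proof.
move=> s; exact: (@continuous_max _ _ (cst t) (fun s : R => Num.min s b) s
  (cvg_cst _) (@continuous_minr b s)).
Qed.

(** Path lifting through the exponential. The lift is prolonged by the
    principal logarithm of q / q t0 near the supremum t0 of the times up to
    which a lift exists. *)
Lemma path_lift (q : R -> C) : continuous q -> (forall s, q s != 0) ->
  exists lam : R -> C, continuous lam /\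
    forall s, 0 <= s <= 1 -> cexp (lam s) = q s.
Proof.
move=> cq q0.
pose A : set R := [set t | 0 <= t <= 1 /\ exists lam : R -> C, continuous lam /\
    forall s, 0 <= s <= t -> cexp (lam s) = q s].
have A0 : A 0.
  split; first by rewrite lexx ler01.
  have [d dE] := cexp_surj (q0 0).
  exists (fun=> d); split; first by move=> ?; exact: cvg_cst.
  by move=> s; rewrite -eq_le => /eqP <-.
have hsA : has_sup A by split; [exists 0|exists 1 => t [/andP[]]].
set t0 := sup A.
have t00 : 0 <= t0 by exact: (ub_le_sup hsA.2).
have [e [e0 he]] : exists e : R, 0 < e /\ forall s, `|s - t0| < e ->
    0 < Re (q s / q t0).
  have cqt : (fun s => q s / q t0 : C) @ t0 --> (1 : C).
    rewrite -(divff (q0 t0)); apply: ccvgM; [exact: cq|exact: ccvg_cst].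
  have /cvg_cabsP/(_ _ ltr01)/nbhs_ballP[e e0 h] := cqt.
  exists e; split=> // s se; apply: Re_gt0_near1; rewrite -opprB cabsN.
  by apply: h; rewrite -ball_normE /= distrC.
have [t [/andP[tge0 t1] [lam [clam lamE]]] tt0] := sup_adherent e0 hsA.
have {}tt0 : t0 - e < t by [].
have tle : t <= t0 by apply: (ub_le_sup hsA.2); split; [rewrite tge0|exists lam].
pose b := t0 + e / 2; have e2 : 0 < e / 2 by rewrite divr_gt0.
have tb : t < b by rewrite (le_lt_trans tle)// ltrDl.
pose g : R -> R := fun s => Num.max t (Num.min s b).
have cg : continuous g := @continuous_clip t b.
have gtb s : t <= g s <= b by rewrite /g le_max lexx /= ge_max (ltW tb) ge_min lexx orbT.
have near0 s : t <= s <= b -> 0 < Re (q s / q t0).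
  move=> /andP[ts sb]; apply: he; rewrite ltr_norml ltrBlDr ltrBrDr.
  have : b < t0 + e by rewrite ltrD2l gtr_pMr// invf_lt1// ltr1n.
  rewrite addrC; move: tt0; lra.
pose lam' : R -> C := fun s => lam (Num.min s t) + (clog (q (g s) / q t0) - clog (q t / q t0)).
have clam' : continuous lam'.
  rewrite /lam' {lam'}.
  move=> s; apply: ccvgD.
    apply: (continuous_comp (f := fun s => Num.min s t) (g := lam)); last exact: clam.
    exact: continuous_minr.
  apply: ccvgB; last exact: ccvg_cst.
  apply: (continuous_comp (f := fun s => q (g s) / q t0 : C) (g := clog)).
    apply: ccvgM; last exact: ccvg_cst.
    by apply: (continuous_comp (f := g) (g := q)); [exact: cg|exact: cq].
  by apply: continuous_clog; exact: near0.
have lam'E s : 0 <= s <= b -> cexp (lam' s) = q s.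
  move=> /andP[s0 sb]; rewrite cexpD cexpB.
  rewrite !cexp_clog ?near0 ?gtb ?lexx ?ltW//.
  rewrite /g (min_l sb); case: (leP s t) => st.
    by rewrite divff ?mulr1 ?mulf_neq0 ?invr_eq0 ?q0// lamE ?s0.
  rewrite lamE ?tge0 ?lexx//; field.
  by rewrite !q0.
have [b1|b1] := leP b 1; last first.
  exists lam'; split=> // s /andP[s0 s1]; apply: lam'E.
  by rewrite s0 (le_trans s1)// ltW.
have : A b by split; [rewrite b1 (le_trans tge0)// ltW|exists lam'].
by move/(ub_le_sup hsA.2); rewrite -/t0 /b gerDl leNgt e2.
Qed.

End Logarithm.

(** * Logarithms on the complement of a path in the sphere *)

Section PathLogarithm.
Variable R : realType.
Local Notation C := (Cplx R).
Local Notation Re := (@complex.Re _).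
Local Notation Im := (@complex.Im _).
Local Notation cexp := (@cexp R).

Lemma cdiff_clog (V : normedModType R[i]) (f : V -> C) x :
  differentiable f x -> 0 < Re (f x) -> differentiable (fun y => clog (f y)) x.
Proof.
move=> df fx; apply: cdiff_comp => //.
apply: (@differentiable_log R _ (fun z => z)).
- exact: continuous_clog.
- have [e [e0 he]] : exists e : R, 0 < e /\ forall w : C, cabs (w - f x) < e -> 0 < Re w.
    exists (Re (f x)); split=> // w /(le_lt_trans (Re_le_cabs _)).
    by rewrite ReD ReN ltr_norml => /andP[+ _]; rewrite ltrBrDr addNr.
  by apply/nbhs_cabsP; exists e; split=> // z /he; exact: cexp_clog.
- exact: cdiff_id.
Qed.

Definition log_change (q : R -> C) (d : C) : Prop :=
  exists lam : R -> C, [/\ continuous lam,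
    forall s, 0 <= s <= 1 -> cexp (lam s) = q s & d = lam 1 - lam 0].

Lemma log_change_exists (q : R -> C) : continuous q -> (forall s, q s != 0) ->
  exists d, log_change q d.
Proof.
move=> cq q0; have [lam [clam lamE]] := path_lift cq q0.
by exists (lam 1 - lam 0), lam.
Qed.

Lemma log_change_unique q d d' : log_change q d -> log_change q d' -> d = d'.
Proof.
move=> [l [cl lE ->]] [l' [cl' lE' ->]].
have : l 1 - l' 1 = l 0 - l' 0.
  apply: (@log_const_segment R (fun s => l s - l' s) 0 1 1 ler01).
    apply: continuous_subspaceT => s.
    by apply: ccvgB; [exact: cl|exact: cl'].
  move=> s s01; rewrite cexpB lE// lE'// divff// -lE//.
  exact: cexp_neq0.
move=> e; have -> : l 1 = (l 1 - l' 1) + l' 1 by ring.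
rewrite e; ring.
Qed.

(** The principal logarithm of q' / q, added to a lift of q, gives a lift of q'. *)
Lemma log_change_perturb (q q' : R -> C) (d : C) : continuous q -> continuous q' ->
  (forall s, q s != 0) -> (forall s, 0 < Re (q' s / q s)) -> log_change q d ->
  log_change q' (d + (clog (q' 1 / q 1) - clog (q' 0 / q 0))).
Proof.
move=> cq cq' q0 pos [l [cl lE ->]].
exists (fun s => l s + clog (q' s / q s)); split.
- move=> s; apply: ccvgD; first exact: cl.
  apply: (continuous_comp (f := fun s => q' s / q s : C) (g := @clog R)).
    by apply: ccvgM; [exact: cq'|apply: ccvgV; [exact: q0|exact: cq]].
  exact: continuous_clog.
- by move=> s s01; rewrite cexpD lE// cexp_clog// mulrC divfK.
- ring.
Qed.

Lemma log_change_cst (c : C) : c != 0 -> log_change (fun=> c) 0.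
Proof.
move=> /cexp_surj[d dE]; exists (fun=> d); split=> //; last by rewrite subrr.
by move=> s; exact: cvg_cst.
Qed.

(** The counterpart of [hol_at] for functions of the base point alone. *)
Definition hol1_at (l : sphere R -> C) (p : sphere R) : Prop :=
  match p with
  | Some a => differentiable (fun z : C => l (Some z)) a
  | None => differentiable (fun w : C => l (sphere_inv w)) (0 : C)
  end.

Lemma C_hausdorff : hausdorff_space C.
Proof. exact: norm_hausdorff. Qed.

Lemma segment_image_compact (k : R -> C) :
  {within `[0, 1], continuous k} -> compact (k @` `[0, 1]).
Proof. by move=> ck; apply: continuous_compact => //; exact: segment_compact. Qed.

(** The value at z is the change of a logarithm of z - k s as s runs from 1 to 0.
    It is holomorphic in z because moving z slightly multiplies z - k s by a factor
    near 1, as does replacing z - k s by the constant z when z is near infinity. *)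
Lemma path_log (k : R -> C) : {within `[0, 1], continuous k} ->
  exists l : sphere R -> C,
    (forall p, ~ (Some @` (k @` `[0, 1])) p -> hol1_at l p) /\
    forall z : C, ~ (k @` `[0, 1]) z ->
      cexp (l (Some z)) = (z - k 0) / (z - k 1).
Proof.
move=> ck; set K := k @` _; pose kk := k \o @clamp R.
have ckk : continuous kk := continuous_clamped ck.
have kkK s : K (kk s) by exists (clamp s) => //=; rewrite in_itv /= clamp_in.
have kk0 : kk 0 = k 0 by rewrite /kk /= clampK// lexx ler01.
have kk1 : kk 1 = k 1 by rewrite /kk /= clampK// lexx ler01.
have cz (z : C) : continuous (fun s => z - kk s : C).
  by move=> s; apply: ccvgB; [exact: ccvg_cst|exact: ckk].
have zn0 (z : C) (s : R) : ~ K z -> z - kk s != 0.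
  by move=> nK; apply/eqP => /eqP; rewrite subr_eq0 => /eqP zk; apply: nK; rewrite zk.
pose l (p : sphere R) : C := match p with
  | Some z => - xget 0 [set d | log_change (fun s => z - kk s) d]
  | None => 0 end.
have lE (z : C) (d : C) : log_change (fun s => z - kk s) d -> l (Some z) = - d.
  move=> h; congr (- _); apply: xget_subset1 => //= x y hx hy.
  exact: log_change_unique hx hy.
have lex (z : C) : ~ K z -> log_change (fun s => z - kk s) (- l (Some z)).
  move=> nK; have [d dE] := log_change_exists (cz z) (fun s => zn0 z s nK).
  by rewrite (lE _ _ dE) opprK.
have lexp (z : C) : ~ K z -> cexp (l (Some z)) = (z - k 0) / (z - k 1).
  move=> nK; have [lam [_ lamE e]] := lex z nK.
  have -> : l (Some z) = lam 0 - lam 1 by rewrite -[LHS]opprK e opprB.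
  by rewrite cexpB !lamE ?lexx ?ler01// kk0 kk1.
have cK : closed K by apply: compact_closed (segment_image_compact ck); exact: C_hausdorff.
exists l; split=> // -[z0 nK0|_]; rewrite /hol1_at.
- have {}nK0 : ~ K z0 by move=> h; apply: nK0; exists z0.
  have /nbhs_cabsP[e [e0 he]] : nbhs z0 (~` K).
    by apply: open_nbhs_nbhs; split=> //; exact: closed_openC.
  have near (z : C) (s : R) : cabs (z - z0) < e -> cabs ((z - kk s) / (z0 - kk s) - 1) < 1.
    move=> ze; have n0 := zn0 z0 s nK0.
    have -> : (z - kk s) / (z0 - kk s) - 1 = (z - z0) / (z0 - kk s) by field.
    rewrite cabsM cabsV ltr_pdivrMr ?cabs_gt0// mul1r.
    rewrite (lt_le_trans ze)// leNgt; apply/negP => h.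
    by apply: (he (kk s)) (kkK s); rewrite -opprB cabsN.
  have locE (z : C) : cabs (z - z0) < e -> l (Some z) = l (Some z0) -
      (clog ((z - kk 1) / (z0 - kk 1)) - clog ((z - kk 0) / (z0 - kk 0))).
    move=> ze; have := log_change_perturb (cz z0) (cz z) (fun s => zn0 z0 s nK0)
      (fun s => Re_gt0_near1 (near z s ze)) (lex z0 nK0).
    by move/lE => ->; rewrite opprD opprK.
  apply: (@differentiable_near R _ _ _ (fun z : C => l (Some z0) -
      (clog ((z - kk 1) / (z0 - kk 1)) - clog ((z - kk 0) / (z0 - kk 0))))).
    by apply/nbhs_cabsP; exists e; split=> // z /locE.
  have dclog (s : R) :
      differentiable (fun z : C => clog ((z - kk s) / (z0 - kk s))) z0.
    apply: cdiff_clog; last by rewrite divff ?zn0//= ltr01.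
    apply: cdiffM; last exact: cdiff_cst.
    by apply: cdiffB; [exact: cdiff_id|exact: cdiff_cst].
  apply: cdiffB; first exact: cdiff_cst.
  by apply: cdiffB; exact: dclog.
- have [M [M0 hM]] : exists M : R, 0 < M /\ forall s, cabs (kk s) <= M.
    have cc : {within `[0, 1], continuous (fun s => cabs (kk s))}.
      apply: continuous_subspaceT => s.
      by apply: (continuous_comp (ckk s)); exact: continuous_cabs.
    have [c c01 hc] := EVT_max ler01 cc.
    exists (cabs (kk c) + 1); split; first by rewrite ltr_pwDr// cabs_ge0.
    move=> s; have -> : kk s = kk (clamp s).
      by rewrite /kk /= (clampK (clamp_in s)).
    rewrite (le_trans (hc (clamp s) _)) ?lerDl//.
    by rewrite in_itv /= clamp_in.
  have near (w : C) (s : R) : cabs (w - 0) < M^-1 -> cabs ((1 - w * kk s) - 1) < 1.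
    rewrite subr0 => wM; rewrite addrAC subrr add0r cabsN cabsM.
    have := cabs_ge0 w; have := hM s; have := cabs_ge0 (kk s).
    have : cabs w * M < 1 by rewrite -ltr_pdivlMr// div1r.
    nra.
  have locE (w : C) : cabs (w - 0) < M^-1 ->
      l (sphere_inv w) = - (clog (1 - w * kk 1) - clog (1 - w * kk 0)).
    move=> wM; rewrite /sphere_inv; case: eqVneq => [->|w0].
      by rewrite !mul0r subr0 subrr oppr0.
    (* the path s |-> 1 / w - k s is a perturbation of the constant 1 / w *)
    have wi0 : w^-1 != 0 by rewrite invr_eq0.
    have ratE s : (w^-1 - kk s) / w^-1 = 1 - w * kk s by field.
    have pos s : 0 < Re ((w^-1 - kk s) / w^-1).
      by rewrite ratE; exact: Re_gt0_near1 (near w s wM).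
    have c0 : continuous (fun _ : R => w^-1 : C) by move=> ?; exact: cvg_cst.
    have := log_change_perturb c0 (cz w^-1) (fun=> wi0) pos (log_change_cst wi0).
    by rewrite add0r !ratE => /lE.
  have Mi : 0 < M^-1 by rewrite invr_gt0.
  apply: (@differentiable_near R _ _ _ (fun w : C =>
      - (clog (1 - w * kk 1) - clog (1 - w * kk 0)))).
    by apply/nbhs_cabsP; exists M^-1; split=> // w /locE.
  have dclog (s : R) : differentiable (fun w : C => clog (1 - w * kk s)) (0 : C).
    apply: cdiff_clog; last by rewrite mul0r subr0 /= ltr01.
    apply: cdiffB; first exact: cdiff_cst.
    by apply: cdiffM; [exact: cdiff_id|exact: cdiff_cst].
  by apply: cdiffN; apply: cdiffB; exact: dclog.
Qed.

End PathLogarithm.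

(** * Arcs, discs and arguments in the plane *)

Section PlaneTopology.
Variable R : realType.
Local Notation C := (Cplx R).
Local Notation S := (sphere R).
Local Notation Re := (@complex.Re _).
Local Notation Im := (@complex.Im _).
Local Notation cexp := (@cexp R).

Definition cis (s : R) : C := (cos s +i* sin s)%C.

Lemma cis_exp s : cis s = cexp (0 +i* s)%C.
Proof. by apply: complex_eq; rewrite /= expR0 mul1r. Qed.

Lemma cabs_cis s : cabs (cis s) = 1.
Proof. by rewrite cis_exp cabs_cexp expR0. Qed.

Lemma cis_neq0 s : cis s != 0.
Proof. by rewrite cis_exp cexp_neq0. Qed.

Lemma cisD s t : cis (s + t) = cis s * cis t.
Proof.
by rewrite !cis_exp -cexpD; congr cexp; apply: complex_eq; rewrite /= ?addr0.
Qed.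

Lemma cis_pi : cis pi = -1.
Proof. by apply: complex_eq; rewrite /= ?cospi ?sinpi ?oppr0. Qed.

Lemma cisDpi s : cis (s + pi) = - cis s.
Proof. by rewrite (cisD s pi) cis_pi mulrN1. Qed.

Lemma continuous_cis : continuous cis.
Proof.
move=> s; apply/(cvg_complexP (F := nbhs s)).
by split; [exact: continuous_cos|exact: continuous_sin].
Qed.

Lemma continuous_circle (p : C) (r : R) : continuous (fun s => p + r%:C%C * cis s : C).
Proof.
move=> s; apply: ccvgD; first exact: ccvg_cst.
by apply: ccvgM; [exact: ccvg_cst|exact: continuous_cis].
Qed.

(** A circle inside an arc would be carried into a segment by a continuous
    injection, but a continuous real function on a circle takes the same value at
    some pair of antipodal points. *)
Lemma arc_dense (k : R -> C) (p : C) (U : set C) : {within `[0, 1], continuous k} ->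
  set_inj `[0, 1] k -> nbhs p U -> exists z, U z /\ ~ (k @` `[0, 1]) z.
Proof.
move=> ck kinj /nbhs_cabsP[e [e0 he]]; apply: contrapT => noz.
have sub (z : C) : cabs (z - p) < e -> (k @` `[0, 1]) z.
  by move=> ze; apply: contrapT => nK; apply: noz; exists z; split=> //; exact: he.
pose c s : C := p + (e / 2)%:C%C * cis s.
have cc : continuous c := @continuous_circle p (e / 2).
have cK s : (k @` `[0, 1]) (c s).
  apply: sub; rewrite /c addrAC subrr add0r cabsM cabs_cis mulr1 cabsR.
  by rewrite ger0_norm ?divr_ge0 ?ltW// gtr_pMr// invf_lt1// ltr1n.
pose h (z : C) : R := xget 0 [set t | `[0, 1]%classic t /\ k t = z].
have hP s : `[0, 1]%classic (h (c s)) /\ k (h (c s)) = c s.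
  have [t t01 kt] := cK s.
  exact: (@xgetPex _ 0 [set t | `[0, 1]%classic t /\ k t = c s]) (ex_intro _ t (conj t01 kt)).
have ch : continuous (h \o c).
  apply/continuous_closedP => F cF.
  have -> : (h \o c) @^-1` F = c @^-1` (k @` (`[0, 1] `&` F)).
    apply/seteqP; split=> s /=; first by move=> Fs; exists (h (c s)) => //; have [] := hP s.
    move=> [t [t01 Ft] kt]; have [h01 kh] := hP s.
    by have -> : h (c s) = t; [apply: kinj; rewrite ?inE// kh|].
  have cF' : closed (k @` (`[0, 1] `&` F)).
    apply: compact_closed; first exact: C_hausdorff.
    apply: continuous_compact.
      by apply: continuous_subspaceW ck; exact: subIsetl.
    by apply: compact_closedI => //; exact: segment_compact.
  by move/continuous_closedP: cc; exact.
pose g s : R := h (c s) - h (c (s + pi)).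
have cg : {within `[0, pi], continuous g}.
  apply: continuous_subspaceT => s; apply: cvgB; first exact: ch.
  apply: (continuous_comp (f := fun s : R => s + pi) (g := h \o c)); last exact: ch.
  by apply: cvgD; [exact: cvg_id|exact: cvg_cst].
(* g is odd under a half turn, so it vanishes somewhere *)
have cper s : c (s + pi + pi) = c s by rewrite /c !cisDpi opprK.
have gpi : g pi = - g 0.
  by rewrite /g add0r -[X in c (X + _)]add0r cper opprB.
have [s _ /eqP] : exists2 s, s \in `[0, pi] & g s = 0.
  apply: IVT => //; first exact: pi_ge0.
  rewrite gpi ge_min le_max; case: (lerP 0 (g 0)) => g0.
    by rewrite oppr_le0 g0 orbT.
  by rewrite oppr_ge0 (ltW g0) orbT.
rewrite subr_eq0 => /eqP gs.
have := (hP s).2; rewrite gs (hP (s + pi)).2 => /addrI.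
have e2 : (e / 2)%:C%C != 0 :> C.
  by rewrite eq_complex /= eqxx andbT gt_eqF// divr_gt0.
move/(mulfI e2); rewrite cisDpi => /eqP.
by rewrite eq_sym -addr_eq0 -mulr2n mulrn_eq0 /= (negPf (cis_neq0 s)).
Qed.

Lemma continuous_dist (c : C) : continuous (fun z : C => cabs (z - c)).
Proof.
move=> z; apply: (continuous_comp (f := fun z : C => z - c : C) (g := @cabs R)).
  apply: differentiable_continuous.
  by apply: cdiffB; [exact: cdiff_id|exact: cdiff_cst].
exact: continuous_cabs.
Qed.

Lemma closed_disc_closed (c : C) (r : R) : closed (closed_disc c r).
Proof.
have -> : closed_disc c r = (fun z : C => cabs (z - c)) @^-1` [set x | x <= r].
  by apply/seteqP; split=> z; rewrite /closed_disc /= normE lecR.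
by have /continuous_closedP := @continuous_dist c; apply; exact: closed_le.
Qed.

Lemma closed_disc_compact (c : C) (r : R) : compact (closed_disc c r).
Proof.
pose sq := `[- r, r]%classic `*` `[- r, r]%classic : set (R * R).
pose f (x : R * R) : C := c + (x.1 +i* x.2)%C.
have cf : continuous f.
  move=> x; apply: ccvgD; first exact: ccvg_cst.
  apply/(cvg_complexP (F := nbhs x)) => /=.
  by split; [exact: cvg_fst|exact: cvg_snd].
apply: (subclosed_compact (closed_disc_closed (c := c) (r := r))).
  apply: (@continuous_compact _ _ f sq); first exact: continuous_subspaceT.
  by apply: compact_setX; exact: segment_compact.
move=> z; rewrite /closed_disc /= normE lecR => zr.
exists (Re (z - c), Im (z - c)).
  split; rewrite /= in_itv /= -ler_norml; apply: le_trans zr.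
    exact: Re_le_cabs.
  exact: Im_le_cabs.
rewrite /f /=; have -> : (Re (z - c) +i* Im (z - c))%C = z - c by case: (z - c).
by rewrite addrC subrK.
Qed.

Lemma open_sphereC (K : set C) : compact K -> open (~` (Some @` K : set S)).
Proof.
move=> cK; have clK : closed K by apply: compact_closed; first exact: C_hausdorff.
rewrite openE => -[z|] /= nK.
  have Kz : nbhs z (~` K).
    apply: open_nbhs_nbhs; split; first exact: closed_openC.
    by move=> Kz; apply: nK; exists z.
  suff : nbhs z (Some @^-1` ~` (Some @` K : set S)) by [].
  by apply: filterS Kz => y nKy [w Kw [wy]]; apply: nKy; rewrite -wy.
exists K => //; move=> p [[w nw <-] [v Kv [vw]]|-> [v _]] //.
by apply: nw; rewrite -vw.
Qed.

Lemma open_Some (U : set C) : open (Some @` U : set S) <-> open U.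
Proof.
split=> [oU|]; last exact: one_point_compactification_open_some.
rewrite openE => z Uz; move: oU; rewrite openE => /(_ (Some z)).
move=> /(_ (ex_intro2 _ _ z Uz erefl)) h.
have {}h : nbhs z (Some @^-1` (Some @` U : set S)) by [].
by apply: filterS h => w [v Uv [<-]].
Qed.

(** The first half of simple connectedness. *)
Definition path_connected (A : set C) : Prop :=
  forall a b, A a -> A b -> exists k : R -> C,
    [/\ {within `[0, 1], continuous k}, k @` `[0, 1] `<=` A, k 0 = a & k 1 = b].

Lemma log_const (A : set C) (D : C -> C) (v : C) : path_connected A ->
  (forall z, A z -> {for z, continuous D}) -> (forall z, A z -> cexp (D z) = v) ->
  exists d, forall z, A z -> D z = d.
Proof.
move=> pA cD Dv; have [[a Aa]|nA] := pselect (exists a, A a); last first.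
  by exists 0 => z Az; exfalso; apply: nA; exists z.
exists (D a) => z Az; have [k [ck kA ka kz]] := pA a z Aa Az.
have kkA s : A (k (clamp s)).
  by apply: kA; exists (clamp s) => //=; rewrite in_itv /= clamp_in.
have := @log_const_segment R (fun s => D (k (clamp s))) 0 1 v ler01.
rewrite !clampK ?lexx ?ler01// ka kz; apply=> [|s _]; last exact: Dv.
apply: continuous_subspaceT => s.
apply: (continuous_comp (f := k \o @clamp R) (g := D)).
  exact: continuous_clamped.
by apply: cD; exact: kkA.
Qed.

Definition log_of_arg (c : C) (theta : C -> R) (z : C) : C :=
  (ln (cabs (z - c)) +i* theta z)%C.

Lemma cexp_log_of_arg c A theta z : arg_branch c A theta -> A z -> z != c ->
  cexp (log_of_arg c theta z) = z - c.
Proof.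
move=> [_ h] Az zc; rewrite [RHS](h z Az) normE.
have e : expR (ln (cabs (z - c))) = cabs (z - c) by rewrite lnK// posrE cabs_gt0 subr_eq0.
by apply: complex_eq; rewrite /cexp /= e; ring.
Qed.

Lemma differentiable_log_of_arg c A theta z : open A -> arg_branch c A theta ->
  ~ A c -> A z -> differentiable (log_of_arg c theta) z.
Proof.
move=> oA br nAc Az; have zc (w : C) : A w -> w != c.
  by move=> Aw; apply: contra_notN nAc => /eqP <-.
have nA : nbhs z A by apply: open_nbhs_nbhs.
apply: (@differentiable_log R _ (fun w => w - c)).
- apply/(cvg_complexP (F := nbhs z)) => /=; split.
    apply: (continuous_comp (f := fun w : C => cabs (w - c)) (g := @ln R)).
      exact: continuous_dist.
    by apply: continuous_ln; rewrite cabs_gt0 subr_eq0 zc.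
  have := br.1; rewrite continuous_open_subspace// => h.
  by apply: h; rewrite inE.
- by apply: filterS nA => w Aw; exact: (cexp_log_of_arg br Aw (zc w Aw)).
- by apply: cdiffB; [exact: cdiff_id|exact: cdiff_cst].
Qed.

End PlaneTopology.

(** * Trivializations and extensions of bundles *)

Section BundleTheory.
Variable R : realType.
Local Notation C := (Cplx R).
Local Notation S := (sphere R).

Lemma hol_at_near (U : set C) (g h : S -> C2 R -> C2 R) a z : nbhs a U ->
  (forall b w, U b -> g (Some b) w = h (Some b) w) -> hol_at h (Some a) z ->
  hol_at g (Some a) z.
Proof.
move=> Ua gh; apply: differentiable_near.
have f1 : (fun x : C * C2 R => x.1) @ (a, z) --> a by exact: cvg_fst.
have Ux : nbhs (a, z) ((fun x : C * C2 R => x.1) @^-1` U) := f1 _ Ua.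
by apply: filterS Ux => x; exact: gh.
Qed.

Lemma hol_over_id (U : set S) : hol_over U (fun _ (z : C2 R) => z).
Proof. by move=> [a|] z _; exact: diff_snd. Qed.

Lemma hol_over_comp (U : set S) (g h : S -> C2 R -> C2 R) :
  hol_over U g -> hol_over U h -> hol_over U (fun p z => g p (h p z)).
Proof.
move=> hg hh [a|] z Up.
- apply: (@differentiable_comp _ _ _ _ (fun x : C * C2 R => (x.1, h (Some x.1) x.2))
    (fun x => g (Some x.1) x.2)); last exact: (hg (Some a)).
  by apply: diff_pair; [exact: diff_fst|exact: (hh (Some a))].
- apply: (@differentiable_comp _ _ _ _
    (fun x : C * C2 R => (x.1, h (sphere_inv x.1) x.2))
    (fun x => g (sphere_inv x.1) x.2)); last exact: (hg None).
  by apply: diff_pair; [exact: diff_fst|exact: (hh None)].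
Qed.

Lemma hol_over_sub (U V : set S) (g : S -> C2 R -> C2 R) :
  U `<=` V -> hol_over V g -> hol_over U g.
Proof. by move=> UV hg p z /UV; exact: hg. Qed.

Lemma hol_over_param (U : set S) (phi : C -> C2 R -> C2 R) (l : S -> C) :
  (forall x : C * C2 R, differentiable (fun y : C * C2 R => phi y.1 y.2) x) ->
  (forall p, U p -> hol1_at l p) -> hol_over U (fun p z => phi (l p) z).
Proof.
move=> dphi hl [a|] z Up.
- apply: (@differentiable_comp _ _ _ _ (fun x : C * C2 R => (l (Some x.1), x.2))
    (fun x => phi x.1 x.2)); last exact: dphi.
  apply: diff_pair; last exact: diff_snd.
  apply: (@cdiff_comp _ _ (fun x : C * C2 R => x.1) (fun z : C => l (Some z))).
    exact: diff_fst.
  exact: (hl (Some a)).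
- apply: (@differentiable_comp _ _ _ _
    (fun x : C * C2 R => (l (sphere_inv x.1), x.2))
    (fun x => phi x.1 x.2)); last exact: dphi.
  apply: diff_pair; last exact: diff_snd.
  apply: (@cdiff_comp _ _ (fun x : C * C2 R => x.1) (fun z : C => l (sphere_inv z))).
    exact: diff_fst.
  exact: (hl None).
Qed.

Section Trivializations.
Variables (L : set S) (X : bundle L).

Lemma triv_surj (U : set S) (s : X -> C2 R) p v : trivialization U s -> U p ->
  exists e, proj e = p /\ s e = v.
Proof. by move=> [_ [_ _ surj] _] Up; have [|e _ [<- <-]] := surj (p, v); [split|exists e]. Qed.

Lemma triv_inj (U : set S) (s : X -> C2 R) e1 e2 : trivialization U s ->
  U (proj e1) -> proj e1 = proj e2 -> s e1 = s e2 -> e1 = e2.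
Proof.
move=> [_ [_ inj _] _] U1 p12 s12; apply: inj; rewrite ?inE /= -?p12//.
by rewrite p12 s12.
Qed.

Lemma coord_surj (i : index X) p v : dom i p -> exists e, proj e = p /\ coord i e = v.
Proof.
move=> Dp; have [_ _ surj] := coord_bij i.
by have [|e _ [<- <-]] := surj (p, v); [split|exists e].
Qed.

Lemma coord_inj (i : index X) e1 e2 : dom i (proj e1) -> proj e1 = proj e2 ->
  coord i e1 = coord i e2 -> e1 = e2.
Proof.
move=> D1 p12 s12; have [_ inj _] := coord_bij i.
by apply: inj; rewrite ?inE /= -?p12//; rewrite p12 s12.
Qed.

Lemma triv_sub (U N : set S) (s : X -> C2 R) : open N -> N `<=` U ->
  trivialization U s -> trivialization N s.
Proof.
move=> oN NU ts; split=> //.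
- split=> [e Ne|e1 e2|[p v] [Np _]] //=.
    by rewrite !inE /= => N1 N2 [p12 s12]; apply: triv_inj ts (NU _ N1) p12 s12.
  by have [e [ep ev]] := triv_surj v ts (NU _ Np); exists e; rewrite /= ?ep ?ev.
- move=> i; have [_ _ /(_ i)[g [h [hg hh gh]]]] := ts.
  exists g, h; split.
  + by apply: hol_over_sub hg; exact: setSI.
  + by apply: hol_over_sub hh; exact: setSI.
  + by move=> e /NU; exact: gh.
Qed.

Lemma triv_post (U : set S) (s : X -> C2 R) (g h : S -> C2 R -> C2 R) :
  hol_over U g -> hol_over U h -> (forall p, U p -> cancel (g p) (h p)) ->
  (forall p, U p -> cancel (h p) (g p)) ->
  trivialization U s -> trivialization U (fun e => g (proj e) (s e)).
Proof.
move=> hg hh ghK hgK ts; have [oU _ chart] := ts; split=> //.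
- split=> [e Ue|e1 e2|[p v] [Up _]] //=.
    rewrite !inE /= => U1 U2 [p12]; rewrite -p12 => /(can_inj (ghK _ U1)).
    exact: triv_inj ts U1 p12.
  have [e [ep ev]] := triv_surj (h p v) ts Up; exists e; rewrite /= ?ep//.
  by rewrite ev hgK.
- move=> i; have [g' [h' [hg' hh' gh']]] := chart i.
  exists (fun p z => g p (g' p z)), (fun p z => h' p (h p z)); split.
  + by apply: hol_over_comp => //; apply: hol_over_sub hg; exact: subIsetl.
  + by apply: hol_over_comp => //; apply: hol_over_sub hh; exact: subIsetl.
  + move=> e Ue De; have [se ce] := gh' e Ue De.
    by rewrite -se ghK.
Qed.

End Trivializations.

(** The base lies in the plane so that germs are compared in the single chart
    z |-> Some z. *)
Lemma triv_patch (D : set C) (X : bundle (Some @` D : set S)) (W : set C)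
    (s : X -> C2 R) : open W ->
  (forall p, W p -> exists N t, [/\ open N, N p, N `<=` W,
     trivialization (Some @` N) t &
     forall e z, proj e = Some z -> N z -> s e = t e]) ->
  trivialization (Some @` W) s.
Proof.
move=> oW loc.
have sinj e1 e2 z : proj e1 = Some z -> W z -> proj e1 = proj e2 -> s e1 = s e2 -> e1 = e2.
  move=> p1 Wz p12 s12; have [N [t [oN Nz NW tt st]]] := loc z Wz.
  apply: (triv_inj tt) => //; first by rewrite p1; exists z.
  by rewrite -(st e1 z)// -(st e2 z)// -?p12.
split; first exact/open_Some.
- split=> [e We|e1 e2|[p v] /= [[z Wz <-] _]] //=.
    rewrite !inE /= => -[z Wz z1] _ [p12 s12].
    exact: (sinj _ _ z).
  have [N [t [oN Nz NW tt st]]] := loc z Wz.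
  have Nz' : (Some @` N : set S) (Some z) by exists z.
  have [e [ep ev]] := triv_surj v tt Nz'; exists e; first by rewrite /= ep; exists z.
  by rewrite /= (st e z)// ep ev.
- move=> i.
  pose g p w : C2 R := xget 0 [set v | exists e : X, [/\ proj e = p, coord i e = w & v = s e]].
  pose h p v : C2 R := xget 0 [set w | exists e : X, [/\ proj e = p, s e = v & w = coord i e]].
  have gE e : dom i (proj e) -> g (proj e) (coord i e) = s e.
    move=> De; apply: xget_subset1; first by exists e.
    move=> x y [e1 [p1 c1 ->]] [e2 [p2 c2 ->]]; congr s.
    by apply: (coord_inj (i := i)); rewrite ?p1 ?p2 ?c1 ?c2.
  have hE e z : proj e = Some z -> W z -> h (proj e) (s e) = coord i e.
    move=> pe Wz; apply: xget_subset1; first by exists e.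
    move=> x y [e1 [p1 c1 ->]] [e2 [p2 c2 ->]]; congr coord.
    by apply: (sinj _ _ z); rewrite ?p1 ?p2 ?c1 ?c2.
  have loc2 z : W z -> dom i (Some z) -> exists U g' h', [/\ nbhs z U,
      hol_over (Some @` U) g', hol_over (Some @` U) h',
      forall b w, U b -> g (Some b) w = g' (Some b) w &
      forall b w, U b -> h (Some b) w = h' (Some b) w].
    move=> Wz Dz; have [N [t [oN Nz NW tt st]]] := loc z Wz.
    have [_ _ /(_ i)[g' [h' [hg' hh' gh']]]] := tt.
    have ND : Some @` (N `&` Some @^-1` (dom i : set S)) `<=` (Some @` N : set S) `&` dom i.
      by move=> _ [b [Nb Db] <-]; split=> //; exists b.
    exists (N `&` Some @^-1` (dom i : set S)), g', h'; split.
    + apply: filterI; first by apply: open_nbhs_nbhs.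
      have : nbhs (Some z : S) (dom i) by apply: open_nbhs_nbhs; split=> //; exact: dom_open.
      by [].
    + exact: hol_over_sub hg'.
    + exact: hol_over_sub hh'.
    + move=> b w [Nb Db]; have [e [ep ew]] := coord_surj w Db.
      have De : dom i (proj e) by rewrite ep.
      rewrite -ew -ep gE// (st e b)//.
      by apply: (gh' e _ De).1; rewrite ep; exists b.
    + move=> b v [Nb Db].
      have Nb' : (Some @` N : set S) (Some b) by exists b.
      have [e [ep ev]] := triv_surj v tt Nb'.
      rewrite -ev -(st e b)// -ep (hE e b)//; last exact: NW.
      by rewrite (st e b)//; apply: (gh' e _ _).2; rewrite ep.
  exists g, h; split.
  + move=> p z [[b Wb <-] Db]; have [U [g' [h' [nU hg' _ gg' _]]]] := loc2 b Wb Db.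
    by apply: (hol_at_near nU gg'); apply: hg'; exists b => //; exact: nbhs_singleton.
  + move=> p z [[b Wb <-] Db]; have [U [g' [h' [nU _ hh' _ hh]]]] := loc2 b Wb Db.
    by apply: (hol_at_near nU hh); apply: hh'; exists b => //; exact: nbhs_singleton.
  + move=> e [z Wz ez] De; split; first by rewrite gE.
    by rewrite (hE e z).
Qed.

(** Density of A makes the local extensions agree where they overlap. *)
Lemma triv_extend (D : set C) (X : bundle (Some @` D : set S)) (W A : set C)
    (t0 : X -> C2 R) : open W ->
  (forall p U, W p -> nbhs p U -> exists z, U z /\ A z) ->
  (forall p, W p -> exists N t, [/\ open N, N p,
     trivialization (Some @` N) t &
     forall e z, proj e = Some z -> N z -> A z -> t e = t0 e]) ->
  exists s, trivialization (Some @` W) s /\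
    forall e z, proj e = Some z -> W z -> A z -> s e = t0 e.
Proof.
move=> oW dense loc.
pose good N t := [/\ open N, trivialization (Some @` N) t &
  forall (e : X) z, proj e = Some z -> N z -> A z -> t e = t0 e].
have uniq N1 t1 N2 t2 e z : good N1 t1 -> good N2 t2 -> proj e = Some z ->
    W z -> N1 z -> N2 z -> t1 e = t2 e.
  move=> [oN1 T1 A1] [oN2 T2 A2] ez Wz N1z N2z; apply: contrapT => ne.
  have [i _ Di] : (\bigcup_i dom (b := X) i) (Some z).
    by rewrite dom_cover -ez; exact: proj_base.
  have [_ _ /(_ i)[g1 [h1 [hg1 _ gh1]]]] := T1.
  have [_ _ /(_ i)[g2 [h2 [hg2 _ gh2]]]] := T2.
  set w := coord i e.
  have cont (g : S -> C2 R -> C2 R) N : N z -> hol_over ((Some @` N : set S) `&` dom i) g ->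
      {for z, continuous (fun q : C => g (Some q) w)}.
    move=> Nz hg; apply: differentiable_continuous.
    have dg : hol_at g (Some z) w by apply: hg; split=> //; exists z.
    apply: (@differentiable_comp _ _ _ _ (fun q : C => (q, w))
      (fun x : C * C2 R => g (Some x.1) x.2)); last exact: dg.
    by apply: diff_pair; [exact: cdiff_id|exact: differentiable_cst].
  have c12 : (fun q : C => g1 (Some q) w - g2 (Some q) w) @ z -->
      g1 (Some z) w - g2 (Some z) w.
    exact: (cvgB (cont g1 N1 N1z hg1) (cont g2 N2 N2z hg2)).
  have E1 : t1 e = g1 (Some z) w.
    by rewrite -ez; apply: (gh1 e _ _).1; rewrite ez//; exists z.
  have E2 : t2 e = g2 (Some z) w.
    by rewrite -ez; apply: (gh2 e _ _).1; rewrite ez//; exists z.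
  have n0 : g1 (Some z) w - g2 (Some z) w != 0.
    by rewrite subr_eq0; apply/eqP; rewrite -E1 -E2.
  have Dn : nbhs z (Some @^-1` (dom i : set S)).
    have : nbhs (Some z : S) (dom i) by apply: open_nbhs_nbhs; split=> //; exact: dom_open.
    by [].
  have [q [[[[n12 Dq] N1q] N2q] Aq]] : exists q,
      ((([set q : C | g1 (Some q) w - g2 (Some q) w != 0] `&`
        Some @^-1` (dom i : set S)) `&` N1) `&` N2) q /\ A q.
    apply: (dense z) => //; apply: filterI; last by apply: open_nbhs_nbhs.
    apply: filterI; last by apply: open_nbhs_nbhs.
    by apply: filterI => //; exact: cvgr_neq0 c12 n0.
  have [e' [ep ew]] := coord_surj w Dq.
  move/negP: n12; apply; rewrite subr_eq0; apply/eqP.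
  have -> : g1 (Some q) w = t1 e'.
    by rewrite -ep -ew; apply/esym; apply: (gh1 e' _ _).1; rewrite ep//; exists q.
  have -> : g2 (Some q) w = t2 e'.
    by rewrite -ep -ew; apply/esym; apply: (gh2 e' _ _).1; rewrite ep//; exists q.
  by rewrite (A1 e' q)// (A2 e' q).
pose s (e : X) : C2 R := xget 0 [set v | exists N t,
  good N t /\ (exists z, [/\ proj e = Some z, N z & v = t e])].
have sE N t e z : good N t -> proj e = Some z -> W z -> N z -> s e = t e.
  move=> gNt ez Wz Nz; apply: xget_subset1; first by exists N, t; split=> //; exists z.
  move=> x y [N1 [t1 [G1 [z1 [ez1 Nz1 ->]]]]] [N2 [t2 [G2 [z2 [ez2 Nz2 ->]]]]].
  have {}ez1 : z1 = z by move: ez1; rewrite ez => -[].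
  have {}ez2 : z2 = z by move: ez2; rewrite ez => -[].
  by subst z1 z2; exact: (uniq N1 t1 N2 t2 e z).
exists s; split; last first.
  move=> e z ez Wz Az; have [N [t [oN Nz tt AE]]] := loc z Wz.
  by rewrite (sE N t e z)// (AE e z).
apply: triv_patch => // p Wp; have [N [t [oN Np tt AE]]] := loc p Wp.
exists (N `&` W), t; split=> //; first exact: openI.
- by apply: triv_sub tt; [apply/open_Some; exact: openI|exact: image_subset].
- by move=> e z ez [Nz Wz]; exact: (sE N t e z).
Qed.

(** The charts of Y, read on X: this is what an embedding of X into Y over the
    base amounts to. *)
Definition charts_on (L B : set S) (X : bundle L) (Y : bundle B)
    (s : index Y -> X -> C2 R) : Prop :=
  (forall j, trivialization (dom j `&` L) (s j)) /\
  forall i j e, dom i (proj e) -> dom j (proj e) ->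
    s i e = trans i j (proj e) (s j e).

Lemma charts_on_is_extension (L B : set S) (X : bundle L) (Y : bundle B) s :
  L `<=` B -> charts_on (X := X) (Y := Y) s -> is_extension X Y.
Proof.
move=> sub [tr comp]; exists sub; set Z := restriction _ _ _.
have cover p : L p -> exists j : index Y, dom j p.
  move=> Lp; have [j _ Dj] : (\bigcup_i dom (b := Y) i) p.
    by rewrite dom_cover; exact: (sub p Lp).
  by exists j.
have exF (e : X) : exists y : Z, proj y = proj e /\
    forall j : index Y, dom j (proj e) -> coord (b := Z) j y = s j e.
  have Le := proj_base e; have [j Dj] := cover _ Le.
  have [y [yp yc]] := @coord_surj L Z j (proj e) (s j e) (conj Dj Le).
  exists y; split=> // i Di; rewrite (comp i j)// -yc -yp.
  by apply: (@transE _ _ Z i j y); split; rewrite ?yp.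
have exG (y : Z) : exists e : X, proj e = proj y /\
    forall j : index Y, dom j (proj y) -> s j e = coord (b := Z) j y.
  have Ly := proj_base y; have [j Dj] := cover _ Ly.
  have [e [ep ec]] := triv_surj (coord (b := Z) j y) (tr j) (conj Dj Ly).
  exists e; split=> // i Di; rewrite (comp i j) ?ep// ec.
  by apply/esym; apply: (@transE _ _ Z i j y); split.
pose F e := projT1 (cid (exF e)); pose G y := projT1 (cid (exG y)).
have FP e : proj (F e) = proj e /\
    forall j : index Y, dom j (proj e) -> coord (b := Z) j (F e) = s j e.
  exact: (projT2 (cid (exF e))).
have GP y : proj (G y) = proj y /\
    forall j : index Y, dom j (proj y) -> s j (G y) = coord (b := Z) j y.
  exact: (projT2 (cid (exG y))).
exists F, G; split.
- move=> e; have Le := proj_base e; have [j Dj] := cover _ Le.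
  have [Fp Fc] := FP e; have [Gp Gc] := GP (F e).
  apply: (triv_inj (tr j)); rewrite ?Gp ?Fp//.
  by rewrite Gc ?Fp// Fc.
- move=> y; have Ly := proj_base y; have [j Dj] := cover _ Ly.
  have [Fp Fc] := FP (G y); have [Gp Gc] := GP y.
  apply: (@coord_inj L Z j); rewrite ?Fp ?Gp//.
  by rewrite Fc ?Gp// Gc.
- by move=> e; exact: (FP e).1.
- move=> i j; have [_ _ /(_ i)[g [h [hg hh gh]]]] := tr j; exists g; split.
    by apply: hol_over_sub hg => p [].
  move=> e Di Dj; have [Fp Fc] := FP e; rewrite Fp in Dj.
  by rewrite Fc; [exact: (gh e Dj Di).1|case: Dj].
- move=> j i; have [_ _ /(_ i)[g [h [hg hh gh]]]] := tr j; exists h; split=> //.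
  move=> y Dj Di; have [Gp Gc] := GP y; rewrite -Gc; last by case: Dj.
  by rewrite Gp in Di; rewrite -Gp; apply: (gh (G y) _ _).2; rewrite Gp.
Qed.

Lemma charts_on_restriction (L B B' : set S) (X : bundle L) (Y : bundle B) s
    (oB' : open B') (sub : B' `<=` B) : L `<=` B' ->
  charts_on (X := X) (Y := Y) s ->
  charts_on (X := X) (Y := restriction oB' sub Y) s.
Proof.
move=> LB' [tr comp]; split=> [j|i j e [Di _] [Dj _]]; last exact: comp.
apply: triv_sub (tr j); last by move=> p [[Dp _] Lp].
by apply: openI; [apply: openI => //; exact: dom_open|exact: base_open X].
Qed.

End BundleTheory.

(** * Bundles over the sphere glued by flows *)

Section FlowBundle.
Variable R : realType.
Local Notation C := (Cplx R).
Local Notation S := (sphere R).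

Definition hol_flow (phi : C -> C2 R -> C2 R) : Prop :=
  [/\ forall x : C * C2 R, differentiable (fun y : C * C2 R => phi y.1 y.2) x,
      forall z, phi 0 z = z &
      forall s t z, phi (s + t) z = phi s (phi t z)].

Lemma hol_flowK phi t : hol_flow phi -> cancel (phi t) (phi (- t)).
Proof. by move=> [_ p0 pD] z; rewrite -pD addNr. Qed.

Lemma hol_flowNK phi t : hol_flow phi -> cancel (phi (- t)) (phi t).
Proof. by move=> [_ p0 pD] z; rewrite -pD subrr. Qed.

Lemma hol1_atN (l : S -> C) p : hol1_at l p -> hol1_at (fun q => - l q) p.
Proof. by case: p => [a|] h; apply: cdiffN. Qed.

Section Construction.
Variables (n : nat) (K : 'I_n.+1 -> set C) (phi : 'I_n.+1 -> C -> C2 R -> C2 R)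
  (l : 'I_n.+1 -> S -> C).
Hypotheses (cK : forall j, compact (K j)) (dK : trivIset setT K)
  (fphi : forall j, hol_flow (phi j))
  (hl : forall j p, ~ (Some @` K j : set S) p -> hol1_at (l j) p).

Let disj i j z : K i z -> K j z -> i = j.
Proof. by move=> Ki Kj; apply: dK => //; exists z. Qed.

Let fdom j : set S := ~` \bigcup_(k in [set k | k != j]) (Some @` K k).

Let fdom_open j : open (fdom j).
Proof.
apply: closed_openC; apply: closed_bigcup; first exact: finite_finset.
by move=> k _; rewrite -[X in closed X]setCK; apply: open_closedC; exact: open_sphereC.
Qed.

Let fdom_cover : \bigcup_j fdom j = setT.
Proof.
apply/seteqP; split=> // p _.
have [[j [z Kz zp]]|nK] := pselect (exists j, (Some @` K j : set S) p).
  exists j => //; move=> [k kj [w Kw wp]].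
  move: wp; rewrite -zp => -[wz]; rewrite wz in Kw.
  by move/eqP: kj; apply; exact: disj Kz.
by exists ord0 => // -[k _ Kp]; apply: nK; exists k.
Qed.

Let fcoord j (e : S * C2 R) : C2 R :=
  if pselect ((Some @` K j : set S) e.1) then e.2 else phi j (l j e.1) e.2.

Let fcoord_bij j : set_bij (fst @^-1` fdom j) (fdom j `*` setT)
  (fun e : S * C2 R => (e.1, fcoord j e)).
Proof.
split=> [e De|[p1 z1] [p2 z2]|[p v] [/= Dp _]] //=.
  rewrite !inE /= => D1 D2 [p12]; rewrite /fcoord /= -p12; case: pselect => [_ /= -> //|_ /=].
  by move/(can_inj (hol_flowK (l j p1) (fphi j))) => ->.
rewrite /fcoord; case: (pselect ((Some @` K j : set S) p)) => Kp.
  by exists (p, v) => //=; case: pselect.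
exists (p, phi j (- l j p) v) => //=; case: pselect => // ? /=.
by rewrite hol_flowNK.
Qed.

Definition flow_trans i j (p : S) (z : C2 R) : C2 R :=
  if i == j then z else phi i (l i p) (phi j (- l j p) z).

Let ftransE i j (e : S * C2 R) : fdom i e.1 -> fdom j e.1 ->
  fcoord i e = flow_trans i j e.1 (fcoord j e).
Proof.
move=> Di Dj; rewrite /flow_trans; case: eqVneq => [-> //|ij].
rewrite /fcoord; case: pselect => [Ki|? /=]; first by exfalso; apply: Dj; exists i.
case: pselect => [Kj|? /=]; first by exfalso; apply: Di; exists j; rewrite //= eq_sym.
by rewrite hol_flowK.
Qed.

Let ftrans_hol i j : hol_over (fdom i `&` fdom j) (flow_trans i j).
Proof.
rewrite /flow_trans; case: eqVneq => [_|ij]; first exact: hol_over_id.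
apply: (hol_over_comp (g := fun p => phi i (l i p)) (h := fun p => phi j (- l j p))).
  apply: (hol_over_param (l := l i)); first by case: (fphi i).
  by move=> p [Di Dj]; apply: hl => Kp; apply: Dj; exists i.
apply: (hol_over_param (l := fun p => - l j p)); first by case: (fphi j).
move=> p [Di Dj]; apply: hol1_atN; apply: hl => Kp; apply: Di; exists j => //=.
by rewrite eq_sym.
Qed.

(** A point p off all the cuts lies in every chart, and the fiber coordinate z of
    the total space reads phi j (l j p) z in the j-th one. A point of K j lies in the
    j-th chart only, where the coordinate is z. *)
Definition flow_bundle : bundle (setT : set S) :=
  Bundle openT (fun _ => I) fdom_open fdom_cover fcoord_bij ftransE ftrans_hol.

Lemma flow_bundle_trans (i j : 'I_n.+1) :
  @trans R setT flow_bundle i j = flow_trans i j.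
Proof. by []. Qed.

Section Embedding.
Variables (D : set C) (X : bundle (Some @` D : set S)) (tau : X -> C2 R).
Let cut := D `\` \bigcup_j K j.
Hypotheses (triv_tau : trivialization (Some @` cut) tau)
  (dense : forall j p U, D p -> K j p -> nbhs p U -> exists z, U z /\ ~ K j z)
  (cross : forall j p, D p -> K j p -> exists (U : set C) (m : C -> C) sigma,
     [/\ open U, U p, forall z, U z -> differentiable m z,
         trivialization (Some @` U) sigma &
         forall (e : X) z, proj e = Some z -> U z -> cut z ->
           phi j (l j (Some z)) (tau e) = phi j (m z) (sigma e)]).

Let oD : open D.
Proof. exact: (open_Some D).1 (base_open X). Qed.

Let cK_closed A : closed (\bigcup_(j in A) K j).
Proof.
apply: closed_bigcup; first exact: finite_finset.
by move=> j _; apply: compact_closed; first exact: C_hausdorff.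
Qed.

(** Near a point of K j, the map e |-> phi j (m z) (sigma e) is a coordinate of X
    across the cut that agrees with phi j (l j) tau off it. By density these local
    coordinates patch to a chart of X, and two such charts are related off the
    cuts by the transition maps of the bundle over the sphere. *)
Lemma flow_bundle_charts : exists s, charts_on (X := X) (Y := flow_bundle) s.
Proof.
pose W j := D `\` \bigcup_(k in [set k | k != j]) K k.
have oW j : open (W j).
  by apply: openI; [exact: oD|apply: closed_openC; exact: cK_closed].
have cutW j : cut `<=` W j.
  by move=> z [Dz nz]; split=> // -[k _ Kz]; apply: nz; exists k.
have Wcut j z : W j z -> ~ K j z -> cut z.
  move=> [Dz nz] nK; split=> // -[k _ Kz]; have [kj|kj] := eqVneq k j.
    by apply: nK; rewrite -kj.
  by apply: nz; exists k.
have ex j : exists s, trivialization (Some @` W j) s /\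
    forall e z, proj e = Some z -> W j z -> cut z -> s e = phi j (l j (proj e)) (tau e).
  apply: (triv_extend (t0 := fun e => phi j (l j (proj e)) (tau e))) => //.
    move=> p U Wp Up; have [Kp|nK] := pselect (K j p); last first.
      by exists p; split; [exact: nbhs_singleton|exact: (Wcut j)].
    have UW : nbhs p (U `&` W j) by apply: filterI => //; apply: open_nbhs_nbhs.
    have [z [[Uz Wz] nKz]] := dense Wp.1 Kp UW.
    by exists z; split=> //; exact: (Wcut j).
  move=> p Wp; have [Kp|nK] := pselect (K j p); last first.
    exists cut, (fun e => phi j (l j (proj e)) (tau e)); split=> //.
    - by apply: openI; [exact: oD|apply: closed_openC; exact: cK_closed].
    - exact: (Wcut j).
    - have hlj q : (Some @` cut : set S) q -> hol1_at (l j) q.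
        move=> [z [Dz nz] <-]; apply: hl => -[w Kw [wz]]; apply: nz.
        by exists j => //; rewrite -wz.
      apply: (triv_post (g := fun q => phi j (l j q))
          (h := fun q => phi j (- l j q))) => //.
      + by apply: hol_over_param => //; case: (fphi j).
      + apply: (hol_over_param (l := fun q => - l j q)); first by case: (fphi j).
        by move=> q /hlj; exact: hol1_atN.
      + by move=> q _; exact: hol_flowK.
      + by move=> q _; exact: hol_flowNK.
  have [U [m [sigma [oU Up dm ts agree]]]] := cross Wp.1 Kp.
  pose mS (q : S) : C := if q is Some z then m z else 0.
  have hm q : (Some @` U : set S) q -> hol1_at mS q by move=> [z Uz <-]; exact: dm.
  exists U, (fun e => phi j (mS (proj e)) (sigma e)); split=> //.
  - apply: (triv_post (g := fun q => phi j (mS q))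
      (h := fun q => phi j (- mS q))) => //.
    + by apply: hol_over_param => //; case: (fphi j).
    + apply: (hol_over_param (l := fun q => - mS q)); first by case: (fphi j).
      by move=> q /hm; exact: hol1_atN.
    + by move=> q _; exact: hol_flowK.
    + by move=> q _; exact: hol_flowNK.
  - by move=> e z ez Uz cz; rewrite ez /mS -(agree e z).
have [s sP] := choice ex; exists s; split=> [j|i j e Di Dj].
  have -> : dom (b := flow_bundle) j `&` Some @` D = Some @` W j.
    apply/seteqP; split=> p.
      move=> [Dp [z Dz zp]]; exists z => //; split=> // -[k kj Kz].
      by apply: Dp; exists k => //; exists z.
    move=> [z [Dz nz] <-]; split; last by exists z.
    by move=> [k kj [w Kw [wz]]]; apply: nz; exists k => //; rewrite -wz.
  exact: (sP j).1.
rewrite flow_bundle_trans /flow_trans; case: eqVneq => [-> //|ij].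
have [z Dz ez] := proj_base e.
have Wz k : dom (b := flow_bundle) k (proj e) -> W k z.
  by move=> Dk; split=> // -[k' kk' Kz]; apply: Dk; exists k' => //; exists z.
have cz : cut z.
  apply: (Wcut i); first exact: Wz.
  by move=> Ki; apply: (Wz j Dj).2; exists i.
rewrite ((sP i).2 e z)//; last exact: Wz.
rewrite ((sP j).2 e z)//; last exact: Wz.
by rewrite hol_flowK.
Qed.

End Embedding.
End Construction.
End FlowBundle.

(** * Flows on the fiber and polynomial maps *)

Section Flows.
Variable R : realType.
Local Notation C := (Cplx R).

Lemma diff_param (x : C * C2 R) : differentiable (fun y : C * C2 R => y.1) x.
Proof. exact: diff_fst. Qed.

Lemma diff_fiber1 (x : C * C2 R) : differentiable (fun y : C * C2 R => y.2.1) x.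
Proof.
apply: (@differentiable_comp _ _ _ _ (fun y : C * C2 R => y.2) (fun z : C2 R => z.1)).
  exact: diff_snd.
exact: diff_fst.
Qed.

Lemma diff_fiber2 (x : C * C2 R) : differentiable (fun y : C * C2 R => y.2.2) x.
Proof.
apply: (@differentiable_comp _ _ _ _ (fun y : C * C2 R => y.2) (fun z : C2 R => z.2)).
  exact: diff_snd.
exact: diff_snd.
Qed.

(** Multiplying Q by the time gives the flow. *)
Lemma overshear_flow (f : C2 R -> C2 R) : overshear f ->
  exists phi, hol_flow phi /\ forall z, phi 1 z = f z.
Proof.
move=> [Q [eQ [fE|fE]]].
- exists (fun t z => (z.1, z.2 * cexp (t * Q z.1))); split; last first.
    by move=> z; rewrite mul1r fE.
  split=> [x|[z1 z2]|s t [z1 z2]] /=.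
  + apply: diff_pair; first exact: diff_fiber1.
    apply: cdiffM; first exact: diff_fiber2.
    apply: cdiff_exp; apply: cdiffM; first exact: diff_param.
    by apply: (@cdiff_comp _ _ (fun y : C * C2 R => y.2.1) Q); [exact: diff_fiber1|exact: eQ].
  + by rewrite mul0r cexp0 mulr1.
  + by congr pair; rewrite mulrDl cexpD; ring.
- exists (fun t z => (z.1 * cexp (t * Q z.2), z.2)); split; last first.
    by move=> z; rewrite mul1r fE.
  split=> [x|[z1 z2]|s t [z1 z2]] /=.
  + apply: diff_pair; last exact: diff_fiber2.
    apply: cdiffM; first exact: diff_fiber1.
    apply: cdiff_exp; apply: cdiffM; first exact: diff_param.
    by apply: (@cdiff_comp _ _ (fun y : C * C2 R => y.2.2) Q); [exact: diff_fiber2|exact: eQ].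
  + by rewrite mul0r cexp0 mulr1.
  + by congr pair; rewrite mulrDl cexpD; ring.
Qed.

Definition linear_map (f : C2 R -> C2 R) : Prop :=
  exists p q r s : C, forall z, f z = (p * z.1 + q * z.2, r * z.1 + s * z.2).

(** The eigenvalues of M = (z1, z2) |-> (b * z2, c * z1) are mu and - mu, where
    mu ^ 2 = b * c; the projections on the eigenspaces are (1 + M / mu) / 2 and
    (1 - M / mu) / 2, so that mu ^ t ((1 + e ^ (i pi t)) / 2 +
    (1 - e ^ (i pi t)) / 2 * M / mu) is a flow through M. *)
Lemma antidiagonal_flow (b c : C) : b != 0 -> c != 0 ->
  exists phi, [/\ hol_flow phi, forall z, phi 1 z = (b * z.2, c * z.1) &
    forall t, linear_map (phi t)].
Proof.
move=> b0 c0; have bc0 : b * c != 0 by rewrite mulf_neq0.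
have [a0 a0E] := cexp_surj bc0; pose a : C := a0 / 2.
set mu := cexp a; have mu0 : mu != 0 by exact: cexp_neq0.
have mu2 : mu * mu = b * c.
  by rewrite /mu -cexpD -a0E; congr cexp; rewrite /a; field.
have cE : c = mu ^+ 2 / b by rewrite expr2 mu2 [b * c]mulrC mulfK.
pose E (t : C) := cexp (t * a); pose F (t : C) := cexp (t * (0 +i* pi)%C).
have F1 : F 1 = -1 by rewrite /F mul1r -cis_exp cis_pi.
have E1 : E 1 = mu by rewrite /E mul1r.
have ED s t : E (s + t) = E s * E t by rewrite /E mulrDl cexpD.
have FD s t : F (s + t) = F s * F t by rewrite /F mulrDl cexpD.
have E0 : E 0 = 1 by rewrite /E mul0r cexp0.
have F0 : F 0 = 1 by rewrite /F mul0r cexp0.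
have dE (x : C * C2 R) : differentiable (fun y : C * C2 R => E y.1) x.
  by apply: cdiff_exp; apply: cdiffM; [exact: diff_param|exact: cdiff_cst].
have dF (x : C * C2 R) : differentiable (fun y : C * C2 R => F y.1) x.
  by apply: cdiff_exp; apply: cdiffM; [exact: diff_param|exact: cdiff_cst].
exists (fun t z => (E t * ((1 + F t) / 2) * z.1 + E t * ((1 - F t) / 2 / mu * b) * z.2,
                    E t * ((1 - F t) / 2 / mu * c) * z.1 + E t * ((1 + F t) / 2) * z.2)).
split.
- split=> [x|[z1 z2]|s t [z1 z2]] /=.
  + have dA : differentiable (fun y : C * C2 R => E y.1 * ((1 + F y.1) / 2) : C) x.
      apply: cdiffM; first exact: dE.
      apply: cdiffM; last exact: cdiff_cst.
      by apply: cdiffD; [exact: cdiff_cst|exact: dF].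
    have dB d : differentiable
        (fun y : C * C2 R => E y.1 * ((1 - F y.1) / 2 / mu * d) : C) x.
      apply: cdiffM; first exact: dE.
      apply: cdiffM; last exact: cdiff_cst.
      apply: cdiffM; last exact: cdiff_cst.
      apply: cdiffM; last exact: cdiff_cst.
      by apply: cdiffB; [exact: cdiff_cst|exact: dF].
    apply: diff_pair; apply: cdiffD; apply: cdiffM;
      [exact: dA|exact: diff_fiber1|exact: dB|exact: diff_fiber2
      |exact: dB|exact: diff_fiber1|exact: dA|exact: diff_fiber2].
  + by rewrite E0 F0; congr pair; field.
  + rewrite ED FD cE; congr pair; field; by rewrite mu0 b0.
- move=> z; rewrite E1 F1; congr pair; field; exact: mu0.
- by move=> t; exists (E t * ((1 + F t) / 2)), (E t * ((1 - F t) / 2 / mu * b)),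
    (E t * ((1 - F t) / 2 / mu * c)), (E t * ((1 + F t) / 2)).
Qed.

Definition poly_shear (k : nat) (t : C) (z : C2 R) : C2 R :=
  (z.1, z.2 + t * z.1 ^+ k).

Lemma poly_shear_flow k : hol_flow (poly_shear k).
Proof.
split=> [x|[z1 z2]|s t [z1 z2]]; rewrite /poly_shear /=.
- apply: diff_pair; first exact: diff_fiber1.
  apply: cdiffD; first exact: diff_fiber2.
  apply: cdiffM; first exact: diff_param.
  by apply: cdiffX; exact: diff_fiber1.
- by rewrite mul0r addr0.
- by congr pair; ring.
Qed.

Definition poly_fun (h : C2 R -> C) : Prop :=
  exists P : {poly {poly R[i]}}, forall z : C2 R, h z = P.[(z.2)%:P].[z.1].

Lemma poly_funD h1 h2 : poly_fun h1 -> poly_fun h2 -> poly_fun (fun z => h1 z + h2 z).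
Proof. by move=> [P hP] [Q hQ]; exists (P + Q) => z; rewrite hP hQ !hornerD. Qed.

Lemma poly_funM h1 h2 : poly_fun h1 -> poly_fun h2 -> poly_fun (fun z => h1 z * h2 z).
Proof. by move=> [P hP] [Q hQ]; exists (P * Q) => z; rewrite hP hQ !hornerM. Qed.

Lemma poly_fun_cst c : poly_fun (fun=> c).
Proof. by exists c%:P%:P => z; rewrite !hornerC. Qed.

Lemma poly_funX h k : poly_fun h -> poly_fun (fun z => h z ^+ k).
Proof. by move=> [P hP]; exists (P ^+ k) => z; rewrite hP !horner_exp. Qed.

Lemma poly_fun_fst : poly_fun (fun z => z.1).
Proof. by exists ('X)%:P => z; rewrite hornerC hornerX. Qed.

Lemma poly_fun_snd : poly_fun (fun z => z.2).
Proof. by exists 'X => z; rewrite hornerX hornerC. Qed.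

Lemma polynomial_mapP (f : C2 R -> C2 R) : polynomial_map f <->
  poly_fun (fun z => (f z).1) /\ poly_fun (fun z => (f z).2).
Proof.
split=> [[P [Q fE]]|[[P hP] [Q hQ]]].
  by split; [exists P|exists Q] => z; rewrite fE.
by exists P, Q => z; rewrite -hP -hQ; case: (f z).
Qed.

Lemma polynomial_map_id : polynomial_map (@id (C2 R)).
Proof. by apply/polynomial_mapP; split; [exact: poly_fun_fst|exact: poly_fun_snd]. Qed.

Lemma linear_polynomial_map (g f : C2 R -> C2 R) : linear_map g -> polynomial_map f ->
  polynomial_map (fun z => g (f z)).
Proof.
move=> [p [q [r [s gE]]]] /polynomial_mapP[f1 f2]; apply/polynomial_mapP.
have lin c d : poly_fun (fun z => c * (f z).1 + d * (f z).2).
  by apply: poly_funD; apply: poly_funM => //; exact: poly_fun_cst.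
split; [have [P hP] := lin p q|have [P hP] := lin r s]; exists P => z.
  by rewrite -hP gE.
by rewrite -hP gE.
Qed.

Lemma poly_shear_polynomial_map k t (f : C2 R -> C2 R) : polynomial_map f ->
  polynomial_map (fun z => poly_shear k t (f z)).
Proof.
move=> /polynomial_mapP[f1 f2]; apply/polynomial_mapP; split=> //=.
apply: poly_funD => //; apply: poly_funM; first exact: poly_fun_cst.
exact: poly_funX.
Qed.

End Flows.

(** * Bundles over the holed disc *)

Section Holes.
Variable R : realType.
Local Notation C := (Cplx R).
Local Notation S := (sphere R).
Local Notation Re := (@complex.Re _).
Local Notation Im := (@complex.Im _).
Local Notation cexp := (@cexp R).

Definition two_pi_i : C := 'i%C * (2 * pi)%:C%C.

Lemma two_pi_i_neq0 : two_pi_i != 0.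
Proof.
apply/eqP => /(congr1 Im) /=; rewrite mul0r mul1r add0r => /eqP.
by rewrite mulf_eq0 pnatr_eq0 /= gt_eqF// pi_gt0.
Qed.

Lemma log_of_arg_turn (c : C) (theta alpha : C -> R) z :
  theta z = alpha z - 2 * pi -> log_of_arg c theta z = log_of_arg c alpha z - two_pi_i.
Proof.
move=> h; apply: complex_eq; rewrite /log_of_arg ?ReD ?ImD ?ReN ?ImN /= ?h; ring.
Qed.

(** When the argument drops by a full turn, the time parameter of the flow drops
    by 1, which compensates for the gluing map phi 1. *)
Lemma flow_crossing phi (c : C) (theta alpha : C -> R) (z r : C) (v w : C2 R) :
  hol_flow phi ->
  (theta z = alpha z /\ v = w) \/ (theta z = alpha z - 2 * pi /\ v = phi 1 w) ->
  phi ((log_of_arg c theta z + r) / two_pi_i) v =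
  phi ((log_of_arg c alpha z + r) / two_pi_i) w.
Proof.
move=> [_ _ pD] [[h ->]|[h ->]]; first by rewrite /log_of_arg h.
rewrite (log_of_arg_turn c h) -pD; congr (phi _ w).
by field; exact: two_pi_i_neq0.
Qed.

Lemma differentiable_clog1B (b z : C) : cabs z < cabs b ->
  differentiable (fun z : C => clog (1 - z / b)) z /\ cexp (clog (1 - z / b)) = 1 - z / b.
Proof.
move=> zb; have b0 : 0 < cabs b by rewrite (le_lt_trans _ zb)// cabs_ge0.
have pos : 0 < Re (1 - z / b).
  apply: Re_gt0_near1; rewrite addrAC subrr add0r cabsN cabsM cabsV.
  by rewrite ltr_pdivrMr// mul1r.
split; last exact: cexp_clog.
apply: cdiff_clog; last exact: pos.
apply: cdiffB; first exact: cdiff_cst.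
by apply: cdiffM; [exact: cdiff_id|exact: cdiff_cst].
Qed.

(** The exponential of l - log (z - c) - rho is constant, since that of rho is a
    multiple of (z - a) / ((z - b) (z - c)); on a connected domain, the difference
    is then constant itself. When the domain is cut along an arc, l and theta jump
    across the arc while rho may be chosen holomorphic there. *)
Lemma slit_log (A : set C) (l : C -> C) (rho : C -> C) (c a b : C) (theta : C -> R) :
  open A -> path_connected A -> arg_branch c A theta -> ~ A c -> ~ A a -> ~ A b ->
  (forall z, A z -> differentiable l z) ->
  (forall z, A z -> cexp (l z) = (z - a) / (z - b)) ->
  (forall z, A z -> differentiable rho z) ->
  (forall z, A z -> cexp (rho z) * (z - c) * (z - b) = - b * (z - a)) ->
  exists d, forall z, A z -> l z = log_of_arg c theta z + (rho z + d).
Proof.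
move=> oA pA br nc na nb dl lE drho rhoE.
have neq (z w : C) : A z -> ~ A w -> z - w != 0.
  by move=> Az nw; rewrite subr_eq0; apply: contra_notN nw => /eqP <-.
have [d dE] : exists d, forall z, A z -> l z - log_of_arg c theta z - rho z = d.
  apply: (log_const (v := - b^-1) pA) => z Az.
    apply: differentiable_continuous; apply: cdiffB; last exact: drho.
    by apply: cdiffB; [exact: dl|exact: differentiable_log_of_arg oA br nc Az].
  have zc : z != c by rewrite -subr_eq0; exact: neq.
  rewrite cexpB cexpB (lE z Az) (cexp_log_of_arg br Az zc).
  have h1 := neq _ _ Az nc; have h2 := neq _ _ Az na; have h3 := neq _ _ Az nb.
  have b0 : b != 0.
    apply/eqP => b0; have := rhoE z Az; rewrite {2}b0 oppr0 mul0r => /eqP.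
    by rewrite !mulf_eq0 (negPf h1) (negPf h3) (negPf (cexp_neq0 _)).
  have -> : cexp (rho z) = - b * (z - a) / ((z - c) * (z - b)).
    by rewrite -(rhoE z Az); field; rewrite h1 h3.
  by field; rewrite h1 h2 h3 b0.
by exists d => z Az; rewrite -(dE z Az); ring.
Qed.

Lemma continuous_segment_path (a b : C) :
  {within `[0, 1], continuous (fun s : R => a + s%:C%C * (b - a) : C)}.
Proof.
apply: continuous_subspaceT => s; apply: ccvgD; first exact: ccvg_cst.
by apply: ccvgM; [exact: continuous_real_complex|exact: ccvg_cst].
Qed.

Lemma unit_discE (z : C) : unit_disc z <-> cabs z < 1.
Proof.
rewrite /unit_disc /= normE; have -> : (1 : C) = 1%:C%C by [].
by rewrite ltcR.
Qed.

Lemma open_unit_disc : open (@unit_disc R).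
Proof.
have -> : @unit_disc R = @cabs R @^-1` [set x | x < 1].
  by apply/seteqP; split=> z /=; move/unit_discE.
have /continuousP := @continuous_cabs R; apply; exact: open_lt.
Qed.

(** The j-th cut is the closed disc together with its arc, and l j is a logarithm
    of (z - c j) / (z - b j), where b j is the end of the arc on the unit circle: up
    to a constant it is log (z - c j) - log (1 - z / b j), whose second term is
    holomorphic in the unit disc. *)
Lemma bundle_of_holes_extends (n : nat) (c : 'I_n.+1 -> C) (rho : 'I_n.+1 -> R)
    (f : 'I_n.+1 -> C2 R -> C2 R) (X : bundle (Some @` holed_disc c rho : set S)) :
  (forall j, exists phi, hol_flow phi /\ forall z, phi 1 z = f j z) ->
  bundle_of_holes f X ->
  extends_to X setT /\ extends_to X (Some @` @unit_disc R).
Proof.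
move=> /choice[phi phiP] [g [[disc discI arcs gI [conn _]] [tau [theta [Ttau th cross]]]]].
have fphi j : hol_flow (phi j) := (phiP j).1.
set L := holed_disc c rho in X tau arcs conn Ttau th cross *.
have oL : open L := (open_Some L).1 (base_open X).
have [k kP] := choice arcs.
have k0 j : closed_disc (c j) (rho j) (k j 0).
  by have [_ _ _ [h _] _] := kP j; rewrite /closed_disc /= h.
have k1 j : cabs (k j 1) = 1.
  by have [_ _ _ [_ h] _] := kP j; move: h; rewrite /circle /= subr0 normE => /complexI.
have gE j : g j = k j @` `[0, 1] by have [] := kP j.
have Ldisc j z : L z -> ~ closed_disc (c j) (rho j) z.
  by move=> [_ h] Dz; apply: h; exists j.
have Lunit z : L z -> cabs z < 1.
  by move=> [/unit_discE].
have gcase j z : g j z -> closed_disc (c j) (rho j) z \/ cabs z = 1 \/ L z.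
  rewrite gE => -[t] /=; rewrite in_itv /= => /andP[t0 t1] <-.
  have [->|tn0] := eqVneq t 0; first by left; exact: k0.
  have [->|tn1] := eqVneq t 1; first by right; left; exact: k1.
  right; right; have [_ _ _ _] := kP j; apply.
  by rewrite !lt_neqAle eq_sym tn0 tn1 t0.
pose K j := closed_disc (c j) (rho j) `|` g j.
have cg j : compact (g j).
  by rewrite gE; apply: segment_image_compact; have [] := kP j.
have cK j : compact (K j) by apply: compactU; [exact: closed_disc_compact|exact: cg].
have discg i j z : closed_disc (c i) (rho i) z -> g j z -> i = j.
  move=> Dz gz; case: (gcase j z gz) => [Dj|[z1|Lz]].
  - by apply: (discI i j) => //; exists z.
  - by have /unit_discE := (disc i).2 z Dz; rewrite z1 ltxx.
  - by exfalso; exact: Ldisc Lz Dz.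
have dK : trivIset setT K.
  move=> i j _ _ [z [[Di|gi] [Dj|gj]]].
  - by apply: discI => //; exists z.
  - exact: discg Di gj.
  - by apply/esym; exact: discg Dj gi.
  - by apply: gI => //; exists z.
have cutE : L `\` \bigcup_j g j = L `\` \bigcup_j K j.
  apply/seteqP; split=> z [Lz nz]; split=> // -[j _ h]; apply: nz; exists j => //.
    by case: h => // /(Ldisc j z Lz).
  by right.
set cut := L `\` \bigcup_j g j in conn Ttau th cross cutE.
have ocut : open cut.
  apply: openI => //; apply: closed_openC; apply: closed_bigcup; first exact: finite_finset.
  by move=> j _; apply: compact_closed; [exact: C_hausdorff|exact: cg].
(* from the center of the hole to the arc inside the hole, then along the arc *)
have exl j : exists l0 : S -> C, (forall p, ~ (Some @` K j : set S) p -> hol1_at l0 p) /\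
    forall z, ~ K j z -> cexp (l0 (Some z)) = (z - c j) / (z - k j 1).
  have ck : {within `[0, 1], continuous (k j)} by have [] := kP j.
  have [l1 [hl1 l1E]] := path_log (@continuous_segment_path (c j) (k j 0)).
  have [l2 [hl2 l2E]] := path_log ck.
  have seg z : ((fun s : R => c j + s%:C%C * (k j 0 - c j) : C) @` `[0, 1]) z -> K j z.
    move=> [s]; rewrite /= in_itv /= => /andP[s0 s1] <-; left.
    rewrite /closed_disc /= addrAC subrr add0r normE lecR cabsM cabsR ger0_norm//.
    have := k0 j; rewrite /closed_disc /= normE lecR; apply: le_trans.
    by rewrite ler_piMl// cabs_ge0.
  exists (fun p => l1 p + l2 p); split.
    move=> p nK.
    have h1 : hol1_at l1 p.
      by apply: hl1 => -[z /seg Kz zp]; apply: nK; exists z.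
    have h2 : hol1_at l2 p.
      by apply: hl2 => -[z gz zp]; apply: nK; exists z => //; right; rewrite gE.
    by case: p nK h1 h2 => [a|] _ h1 h2; apply: cdiffD.
  move=> z nK; rewrite cexpD l1E; last by move/seg.
  rewrite l2E; last by rewrite -gE => gz; apply: nK; right.
  rewrite mul0r addr0 mul1r [c j + _]addrC subrK.
  have n0 : z - k j 0 != 0.
    by rewrite subr_eq0; apply: contra_notN nK => /eqP ->; left; exact: k0.
  have n1 : z - k j 1 != 0.
    rewrite subr_eq0; apply: contra_notN nK => /eqP ->; right; rewrite gE.
    by exists 1 => //=; rewrite in_itv /= ler01 lexx.
  by field; rewrite n0 n1.
have [l0 l0P] := choice exl.
pose r j (z : C) : C := - clog (1 - z / k j 1).
have cutL z : cut z -> L z by case.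
have dr j z : L z -> differentiable (r j) z.
  move=> Lz; have zb : cabs z < cabs (k j 1) by rewrite k1; exact: Lunit.
  by have [h _] := differentiable_clog1B zb; exact: cdiffN.
have nLc j : ~ L (c j).
  move=> Lc; apply: (Ldisc j _ Lc); rewrite /closed_disc /= subrr normr0.
  by rewrite ler0c ltW//; exact: (disc j).1.
have nLk j : ~ L (k j 1) by move=> /Lunit; rewrite k1 ltxx.
have exd j : exists d, forall z, cut z ->
    l0 j (Some z) = log_of_arg (c j) (theta j) z + (r j z + d).
  apply: (slit_log (a := c j) (b := k j 1) ocut conn (th j)) => //.
  - by move=> /cutL /nLc.
  - by move=> /cutL /nLc.
  - by move=> /cutL /nLk.
  - move=> z; rewrite cutE => -[Lz nz]; apply: ((l0P j).1 (Some z)) => -[w Kw [wz]].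
    by apply: nz; exists j => //; rewrite -wz.
  - move=> z; rewrite cutE => -[Lz nz]; apply: (l0P j).2 => Kz.
    by apply: nz; exists j.
  - by move=> z /cutL; exact: dr.
  - move=> z /cutL Lz; rewrite /r cexpN.
    have zb : cabs z < cabs (k j 1) by rewrite k1; exact: Lunit.
    have [_ ->] := differentiable_clog1B zb.
    have kn0 : k j 1 != 0 by rewrite -cabs_gt0 k1 ltr01.
    have zk : z - k j 1 != 0.
      by rewrite subr_eq0; apply: contra_notN (nLk j) => /eqP <-.
    have zk' : k j 1 - z != 0 by rewrite -opprB oppr_eq0.
    by field; rewrite kn0 zk'.
have [d dE] := choice exd.
pose l j p : C := l0 j p / two_pi_i.
have hl j p : ~ (Some @` K j : set S) p -> hol1_at (l j) p.
  move=> /((l0P j).1 p); case: p => [a|] h; apply: cdiffM => //; exact: cdiff_cst.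
have Ttau' : trivialization (Some @` (L `\` \bigcup_j K j)) tau by rewrite -cutE.
have [||s sP] := flow_bundle_charts cK dK fphi hl Ttau'.
- move=> j p U Lp Kp Up.
  have UL : nbhs p (U `&` L) by apply: filterI => //; apply: open_nbhs_nbhs.
  have ck : {within `[0, 1], continuous (k j)} by have [] := kP j.
  have ik : set_inj `[0, 1] (k j) by have [] := kP j.
  have [z [[Uz Lz] nz]] := arc_dense ck ik UL; exists z; split=> // -[/(Ldisc j z Lz)//|].
  by rewrite gE.
- move=> j p Lp [/(Ldisc j p Lp)//|gp].
  have [U [alpha [sigma [oU Up bra Tsig glue]]]] := cross j p Lp gp.
  have UL z : U z -> L z.
    move=> Uz; have Uz' : (Some @` U : set S) (Some z) by exists z.
    have [e [ep _]] := triv_surj 0 Tsig Uz'.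
    by have [w Lw we] := proj_base e; move: we; rewrite ep => -[<-].
  exists U, (fun z => (log_of_arg (c j) alpha z + (r j z + d j)) / two_pi_i), sigma.
  split; [exact: oU|exact: Up| |exact: Tsig|].
    move=> z Uz; apply: cdiffM; last exact: cdiff_cst.
    apply: cdiffD.
      by apply: differentiable_log_of_arg oU bra _ Uz => /UL /nLc.
    by apply: cdiffD; [exact: dr (UL z Uz)|exact: cdiff_cst].
  move=> e z ez Uz; rewrite -cutE => cz; rewrite /l dE//.
  apply: flow_crossing => //; case: (glue e z ez Uz cz) => -[h1 h2]; [left|right] => //.
  by split=> //; rewrite h2 (phiP j).2.
- split.
    by exists (flow_bundle cK dK fphi hl); apply: charts_on_is_extension sP.
  exists (restriction ((open_Some _).2 open_unit_disc) (@subsetT _ _) (flow_bundle cK dK fphi hl)).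
  apply: charts_on_is_extension; last apply: charts_on_restriction sP.
    by apply: image_subset => z [].
  by apply: image_subset => z [].
Qed.

End Holes.

(** * Bundles over the annulus *)

Section Annulus.
Variable R : realType.
Local Notation C := (Cplx R).
Local Notation S := (sphere R).
Local Notation Re := (@complex.Re _).
Local Notation Im := (@complex.Im _).
Local Notation cexp := (@cexp R).

Definition polar (u : C) (rho s : R) : C := rho%:C%C * u * cis s.

Lemma polarDpi u rho s : polar u rho (s + pi) = - polar u rho s.
Proof. by rewrite /polar cisDpi mulrN. Qed.

Lemma cabs_polar u rho s : cabs u = 1 -> 0 <= rho -> cabs (polar u rho s) = rho.
Proof. by move=> u1 r0; rewrite /polar !cabsM u1 cabs_cis cabsR ger0_norm// !mulr1. Qed.

Lemma polar0 u rho : polar u rho 0 = rho%:C%C * u.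
Proof.
have -> : polar u rho 0 = rho%:C%C * u * 1; last by rewrite mulr1.
by congr (_ * _); apply: complex_eq; rewrite /= ?cos0 ?sin0.
Qed.

Lemma cis2pi s : cis (2 * pi - s : R) = cis (- s).
Proof.
have -> : 2 * pi - s = - s + pi + pi :> R by ring.
by rewrite !cisDpi opprK.
Qed.

Lemma polar_exists (u z : C) : cabs u = 1 -> z != 0 ->
  exists s, 0 <= s < 2 * pi /\ z = polar u (cabs z) s.
Proof.
move=> u1 z0; have u0 : u != 0 by rewrite -cabs_gt0 u1.
have a0 : 0 < cabs z by rewrite cabs_gt0.
have ac0 : (cabs z)%:C%C != 0 :> C by rewrite eq_complex /= eqxx andbT gt_eqF.
pose w := z / ((cabs z)%:C%C * u).
have zw : z = (cabs z)%:C%C * u * w by rewrite /w mulrC divfK// mulf_neq0.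
have w1 : Re w ^+ 2 + Im w ^+ 2 = 1.
  rewrite -sqr_cabs; have : cabs z = cabs z * cabs w.
    by rewrite {1}zw !cabsM u1 cabsR gtr0_norm// mulr1.
  move=> /eqP; rewrite eq_sym -{2}[cabs z]mulr1 => /eqP.
  by move=> /(mulfI (lt0r_neq0 a0)) ->; rewrite expr1n.
have Rew : -1 <= Re w <= 1.
  rewrite -ler_norml -(@ler_pXn2r _ 2)// ?nnegrE// expr1n.
  by rewrite real_normK ?num_real// -w1 lerDl sqr_ge0.
have sw : Num.sqrt (1 - Re w ^+ 2) = `|Im w|.
  by rewrite -w1 addrAC subrr add0r sqrtr_sqr.
have acosR : cos (acos (Re w)) = Re w by rewrite acosK.
have := acos_ge0 Rew; have := acos_lepi Rew; have := pi_gt0 R => p0 ap ag.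
have [Iw|Iw] := lerP 0 (Im w).
  exists (acos (Re w)); split; first by rewrite ag/=; lra.
  rewrite {1}zw /polar; congr (_ * _); apply: complex_eq; rewrite /= ?acosR//.
  by rewrite sin_acos// sw ger0_norm.
exists (2 * pi - acos (Re w)); split.
  have : acos (Re w) != 0.
    apply/eqP => a00; move: acosR; rewrite a00 cos0 => R1.
    by move: w1; rewrite -R1 expr1n => /eqP; rewrite addrC -subr_eq0 addrK sqrf_eq0 lt_eqF.
  move=> an0; have an1 : 0 < acos (Re w) by rewrite lt0r an0 ag.
  by apply/andP; split; lra.
rewrite {1}zw /polar cis2pi; congr (_ * _); apply: complex_eq; rewrite /= ?cosN ?acosR//.
by rewrite sinN sin_acos// sw ltr0_norm// opprK.
Qed.

Lemma continuous_comp_opp (theta : C -> R) (z : C) :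
  {for - z, continuous theta} -> {for z, continuous (fun z : C => theta (- z))}.
Proof.
move=> h; apply: (continuous_comp (f := fun z : C => - z) (g := theta)) => //.
by apply: differentiable_continuous; apply: cdiffN; exact: cdiff_id.
Qed.

Lemma arg_branch_opp (A B : set C) (theta : C -> R) : open A -> open B ->
  (forall z, B z -> A (- z)) -> arg_branch 0 A theta ->
  arg_branch 0 B (fun z => theta (- z) + pi).
Proof.
move=> oA oB BA [cth thE]; split.
  rewrite continuous_open_subspace// => z; rewrite inE => /BA Az.
  have ct : {for - z, continuous theta}.
    by move: cth; rewrite continuous_open_subspace//; apply; rewrite inE.
  exact: (cvgD (continuous_comp_opp ct) (cvg_cst (pi : R))).
move=> z /BA Az; have := thE _ Az; rewrite !subr0 normrN => e.
by have := cisDpi (theta (- z)); rewrite /cis => ->; rewrite mulrN -e opprK.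
Qed.

Variables (r1 r2 : R).
Hypotheses (r10 : 0 < r1) (r12 : r1 < r2).

Let A := annulus r1 r2.

Definition ray (u : C) : set C := [set t%:C%C * u | t in `]r1, r2[].

Definition slit (u : C) (s : R) : C :=
  r1%:C%C * u + s%:C%C * (r2%:C%C * u - r1%:C%C * u).

Let AE z : A z <-> r1 < cabs z < r2.
Proof. by rewrite /A /annulus /= normE !ltcR. Qed.

Let AN z : A z -> A (- z).
Proof. by move/AE => h; apply/AE; rewrite cabsN. Qed.

Let oA : open A.
Proof.
have -> : A = @cabs R @^-1` `]r1, r2[.
  by apply/seteqP; split=> z /=; rewrite in_itv /=; move/AE.
by have /continuousP := @continuous_cabs R; apply; exact: interval_open.
Qed.

Lemma slitE u s : slit u s = (r1 + s * (r2 - r1))%:C%C * u.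
Proof. by rewrite /slit -mulrBl mulrA -mulrDl rmorphD rmorphM rmorphB. Qed.

Lemma slit_ray u z : cabs u = 1 -> A z -> (slit u @` `[0, 1]) z -> ray u z.
Proof.
move=> u1 /AE Az [s]; rewrite /= in_itv /= => /andP[s0 s1] sz.
exists (r1 + s * (r2 - r1)); last by rewrite -sz slitE.
have r0 : 0 <= r1 + s * (r2 - r1).
  by rewrite addr_ge0 ?mulr_ge0 ?subr_ge0// ltW.
by move: Az; rewrite -sz slitE cabsM u1 mulr1 cabsR ger0_norm// /= in_itv.
Qed.

Lemma ray_slit u z : ray u z -> (slit u @` `[0, 1]) z.
Proof.
move=> [t]; rewrite /= in_itv /= => /andP[t1 t2] <-.
have d0 : 0 < r2 - r1 by rewrite subr_gt0.
exists ((t - r1) / (r2 - r1)).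
  rewrite /= in_itv /= ler_pdivlMr// ler_pdivrMr// mul0r mul1r subr_ge0 lerD2r.
  by rewrite !ltW.
by rewrite slitE divfK ?gt_eqF// addrC subrK.
Qed.

Lemma slit_continuous u : {within `[0, 1], continuous (slit u)}.
Proof. exact: continuous_segment_path. Qed.

Lemma slit_compact u : compact (slit u @` `[0, 1]).
Proof. exact: segment_image_compact (@slit_continuous u). Qed.

Lemma slit_inj u : cabs u = 1 -> set_inj `[0, 1] (slit u).
Proof.
move=> u1 s t _ _; rewrite !slitE => /mulIf.
have u0 : u != 0 by rewrite -cabs_gt0 u1.
move=> /(_ u0) /complexI /addrI /mulIf; apply.
by rewrite gt_eqF// subr_gt0.
Qed.

Let cutA u := A `\` ray u.

Let cutA_slit u : cabs u = 1 -> cutA u = A `\` slit u @` `[0, 1].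
Proof.
move=> u1; apply/seteqP; split=> z [Az nz]; split=> //.
  by move=> /(slit_ray u1 Az).
by move/ray_slit.
Qed.

Let open_cutA u : cabs u = 1 -> open (cutA u).
Proof.
move=> u1; rewrite cutA_slit//; apply: openI => //; apply: closed_openC.
by apply: compact_closed; [exact: C_hausdorff|exact: slit_compact].
Qed.

Let polar_cutA u rho s : cabs u = 1 -> r1 < rho < r2 -> 0 < s < 2 * pi ->
  cutA u (polar u rho s).
Proof.
move=> u1 hr /andP[s0 s2]; have rp : 0 < rho by rewrite (lt_trans r10)//; case/andP: hr.
have u0 : u != 0 by rewrite -cabs_gt0 u1.
split; first by apply/AE; rewrite cabs_polar// ltW.
move=> [t]; rewrite /= in_itv /= => /andP[t1 _] te.
have tp : 0 < t by rewrite (lt_trans r10).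
have tr : t = rho.
  have /(congr1 (@cabs R)) := te.
  by rewrite cabs_polar ?ltW// cabsM u1 mulr1 cabsR gtr0_norm.
have c1 : cis s = 1.
  apply: (@mulfI C (rho%:C%C * u)).
    by rewrite mulf_neq0// eq_complex /= eqxx andbT gt_eqF.
  by rewrite mulr1 -tr -[LHS]/(polar u t s) tr -te tr.
have /cos_eq1 : cos s = 1 by have /(congr1 Re) := c1.
by rewrite gtr0_norm// => /(_ s2) s00; rewrite s00 ltxx in s0.
Qed.

Let cutA_polar u z : cabs u = 1 -> cutA u z -> exists rho s,
  [/\ r1 < rho < r2, 0 < s < 2 * pi & z = polar u rho s].
Proof.
move=> u1 [Az nz]; have /AE za := Az.
have z0 : z != 0 by rewrite -cabs_gt0 (lt_trans r10)//; case/andP: za.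
have [s [/andP[s0 s2] zE]] := polar_exists u1 z0.
exists (cabs z), s; split=> //; rewrite s2 andbT lt0r s0 andbT.
apply/eqP => s00; apply: nz; exists (cabs z); first by rewrite /= in_itv.
by rewrite [RHS]zE s00 polar0.
Qed.

Lemma continuous_polar_path u a b c d :
  continuous (fun t : R => polar u (a + t * b) (c + t * d)).
Proof.
move=> t; have aff (x y : R) : {for t, continuous (fun t : R => x + t * y)}.
  by apply: cvgD; [exact: cvg_cst|apply: cvgM; [exact: cvg_id|exact: cvg_cst]].
apply: ccvgM; first apply: ccvgM; last 2 first.
- exact: ccvg_cst.
- apply: (continuous_comp (f := fun t : R => c + t * d) (g := @cis R)).
    exact: aff.
  exact: continuous_cis.
apply: (continuous_comp (f := fun t : R => a + t * b) (g := fun t : R => t%:C%C : C)).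
  exact: aff.
exact: continuous_real_complex.
Qed.

Lemma itv_convex (lo hi x y t : R) : lo < x < hi -> lo < y < hi -> 0 <= t <= 1 ->
  lo < x + t * (y - x) < hi.
Proof.
move=> /andP[x1 x2] /andP[y1 y2] /andP[t0 t1].
have cv (p q : R) : 0 < p -> 0 < q -> 0 < p + t * (q - p).
  move=> p0 q0; have -> : p + t * (q - p) = (1 - t) * p + t * q by ring.
  have [t2|t2] := lerP t (1 / 2).
    have a1 : 0 < (1 - t) * p by apply: mulr_gt0; lra.
    have a2 : 0 <= t * q by apply: mulr_ge0; lra.
    lra.
  have a1 : 0 <= (1 - t) * p by apply: mulr_ge0; lra.
  have a2 : 0 < t * q by apply: mulr_gt0; lra.
  lra.
have h1 := cv (x - lo) (y - lo); have h2 := cv (hi - x) (hi - y).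
rewrite -subr_gt0 -[X in _ && X]subr_gt0; apply/andP; split.
  have -> : x + t * (y - x) - lo = x - lo + t * (y - lo - (x - lo)) by ring.
  by apply: h1; rewrite subr_gt0.
have -> : hi - (x + t * (y - x)) = hi - x + t * (hi - y - (hi - x)) by ring.
by apply: h2; rewrite subr_gt0.
Qed.

Let cutA_connected u : cabs u = 1 -> path_connected (cutA u).
Proof.
move=> u1 a b /(cutA_polar u1)[ra [sa [hra hsa ->]]].
move=> /(cutA_polar u1)[rb [sb [hrb hsb ->]]].
exists (fun t : R => polar u (ra + t * (rb - ra)) (sa + t * (sb - sa))); split.
- by apply: continuous_subspaceT; exact: continuous_polar_path.
- move=> z [t]; rewrite /= in_itv /= => t01 <-.
  by apply: polar_cutA; rewrite ?itv_convex.
- by rewrite !mul0r !addr0.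
- by rewrite !mul1r [ra + _]addrC [sa + _]addrC !subrK.
Qed.

(** Up to a constant, log ((z - r1 u) / (z - r2 u)) - log z is equal to
    log (1 - r1 u / z) - log (1 - z / (r2 u)), which is holomorphic on the annulus. *)
Lemma annulus_log u theta : cabs u = 1 -> arg_branch 0 (cutA u) theta ->
  exists (l : S -> C) (rho : C -> C) (d : C),
  [/\ forall p, ~ (Some @` (slit u @` `[0, 1]) : set S) p -> hol1_at l p,
      forall z, A z -> differentiable rho z &
      forall z, cutA u z -> l (Some z) = log_of_arg 0 theta z + (rho z + d)].
Proof.
move=> u1 br; have [l [hl lE]] := path_log (@slit_continuous u).
have s0 : slit u 0 = r1%:C%C * u by rewrite /slit mul0r addr0.
have s1 : slit u 1 = r2%:C%C * u by rewrite /slit mul1r addrC subrK.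
have r20 : 0 < r2 by rewrite (lt_trans r10).
set a := slit u 0 in lE s0; set b := slit u 1 in lE s1.
have ca : cabs a = r1 by rewrite s0 cabsM u1 mulr1 cabsR gtr0_norm.
have cb : cabs b = r2 by rewrite s1 cabsM u1 mulr1 cabsR gtr0_norm.
have An0 z : A z -> z != 0.
  by move/AE => /andP[h _]; rewrite -cabs_gt0 (lt_trans r10).
have zb z : A z -> cabs z < cabs b by move/AE => /andP[_]; rewrite cb.
have az z : A z -> cabs (1 - a / z - 1) < 1.
  move=> Az; rewrite addrAC subrr add0r cabsN cabsM cabsV ca.
  by rewrite ltr_pdivrMr ?cabs_gt0 ?An0// mul1r; have /AE/andP[] := Az.
pose rho (z : C) : C := clog (1 - a / z) - clog (1 - z / b).
have drho z : A z -> differentiable rho z.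
  move=> Az; apply: cdiffB; last exact: (differentiable_clog1B (zb z Az)).1.
  apply: cdiff_clog; last exact: Re_gt0_near1 (az z Az).
  apply: cdiffB; first exact: cdiff_cst.
  apply: cdiffM; first exact: cdiff_cst.
  by apply: cdiffV; [exact: cdiff_id|exact: An0].
have nA w : ~ (r1 < cabs w < r2) -> ~ cutA u w by move=> h [/AE].
have [|||z||||d dE] := slit_log (l := fun z => l (Some z)) (rho := rho) (a := a) (b := b)
    (open_cutA u1) (cutA_connected u1) br.
- by apply: nA; rewrite /cabs normr0 /= ltNge ltW.
- by apply: nA; rewrite ca ltxx.
- by apply: nA; rewrite cb ltxx andbF.
- rewrite cutA_slit// => -[Az nz]; apply: (hl (Some z)) => -[w sw [wz]].
  by apply: nz; rewrite -wz.
- by move=> z; rewrite cutA_slit// => -[Az nz]; exact: lE.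
- by move=> z [Az _]; exact: drho.
- move=> z [Az _]; rewrite /rho cexpB (differentiable_clog1B (zb z Az)).2.
  rewrite cexp_clog; last exact: Re_gt0_near1 (az z Az).
  have b0 : b != 0 by rewrite -cabs_gt0 cb.
  have zb0 : b - z != 0.
    by rewrite subr_eq0; apply/eqP => bz; have := zb z Az; rewrite bz ltxx.
  by rewrite subr0; field; rewrite b0 zb0 An0.
by exists l, rho, d; split.
Qed.

(** Along a circular arc that avoids the slit, the argument minus the polar angle
    is constant. *)
Lemma theta_opposite u theta rho s : cabs u = 1 -> arg_branch 0 (cutA u) theta ->
  r1 < rho < r2 -> 0 < s < pi -> theta (polar u rho (s + pi)) = theta (polar u rho s) + pi.
Proof.
move=> u1 [cth thE] hr /andP[s0 sp]; have ppi := pi_gt0 R.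
have rp : 0 < rho by rewrite (lt_trans r10)//; case/andP: hr.
have rc0 : rho%:C%C != 0 :> C by rewrite eq_complex /= eqxx andbT gt_eqF.
have incut t : s <= t <= s + pi -> cutA u (polar u rho t).
  by move=> /andP[t1 t2]; apply: polar_cutA => //; apply/andP; split; lra.
have thc t : s <= t <= s + pi -> cis (theta (polar u rho t)) = u * cis t.
  move=> /incut ct; have := thE _ ct; rewrite subr0 normE cabs_polar ?ltW//.
  by rewrite {1}/polar -mulrA => /(mulfI rc0)/esym.
have Dc : {within `[s, s + pi], continuous (fun t => (0 +i* (theta (polar u rho t) - t))%C : C)}.
  apply/subspace_continuousP => t; rewrite /= in_itv /= => /incut ct.
  have cont : {for t, continuous (fun t => (0 +i* (theta (polar u rho t) - t))%C : C)}.
    apply/(cvg_complexP (F := nbhs t)) => /=; split; first exact: cvg_cst.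
    apply: cvgB; last exact: cvg_id.
    apply: (continuous_comp (f := polar u rho) (g := theta)).
      have := @continuous_polar_path u rho 0 0 1 t.
      by under eq_fun do rewrite mulr0 addr0 mulr1 add0r.
    by have := cth; rewrite continuous_open_subspace; [apply; rewrite inE|exact: open_cutA].
  exact: cvg_within_filter cont.
have le_s : s <= s + pi by rewrite lerDl ltW.
have := log_const_segment le_s Dc (v := u).
rewrite -[X in _ -> X]/(_ = _) => /(_ _)/(congr1 Im) /=.
move=> h; have /h : forall t, s <= t <= s + pi -> cexp (0 +i* (theta (polar u rho t) - t))%C = u.
  move=> t /thc; rewrite -cis_exp => e; have : cis (theta (polar u rho t) - t + t) = u * cis t.
    by rewrite subrK.
  by rewrite cisD => /(mulIf (cis_neq0 t)).
lra.
Qed.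

Let ray_opp u z : ray (- u) z <-> ray u (- z).
Proof.
split=> -[t ht tz]; exists t => //; first by rewrite -tz mulrN opprK.
by rewrite mulrN tz opprK.
Qed.

Lemma antipodal_jump u theta z : cabs u = 1 -> arg_branch 0 (cutA u) theta ->
  cutA u z -> ~ ray (- u) z ->
  theta z - theta (- z) = pi \/ theta z - theta (- z) = - pi.
Proof.
move=> u1 br cz nz; have [rho [s [hr /andP[s0 s2] zE]]] := cutA_polar u1 cz.
have ppi := pi_gt0 R; have [sp|sp|sp] := ltrgtP s pi.
- right; have := theta_opposite u1 br hr (s := s); rewrite s0 sp => /(_ isT).
  by rewrite polarDpi -zE => ->; rewrite opprD addrA subrr add0r.
- left; have := theta_opposite u1 br hr (s := s - pi); rewrite subr_gt0 sp ltrBlDr.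
  have -> : s < pi + pi by lra.
  move=> /(_ isT); rewrite subrK -zE => ->.
  have -> : polar u rho (s - pi) = - z.
    by apply/esym; rewrite zE -[X in polar _ _ X](subrK pi) polarDpi opprK.
  by rewrite addrC addKr.
- exfalso; apply/nz/ray_opp; exists rho; first by rewrite /= in_itv.
  by rewrite zE sp -[pi in RHS]add0r polarDpi polar0 opprK.
Qed.

Lemma open_cabs_ball (p : C) (e : R) : open [set z : C | cabs (z - p) < e].
Proof.
have -> : [set z : C | cabs (z - p) < e] = (fun z : C => cabs (z - p)) @^-1` [set x | x < e].
  by [].
by have /continuousP := @continuous_dist R p; apply; exact: open_lt.
Qed.

Lemma ball_path_connected (p : C) (e : R) : path_connected [set z | cabs (z - p) < e].
Proof.
move=> a b /= Ba Bb; exists (fun s : R => a + s%:C%C * (b - a) : C); split.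
- exact: continuous_segment_path.
- move=> z [s]; rewrite /= in_itv /= => s01 <-; have /andP[s0 s1] := s01.
  have -> : a + s%:C%C * (b - a) - p = (1 - s)%:C%C * (a - p) + s%:C%C * (b - p).
    by rewrite rmorphB rmorph1; ring.
  apply: le_lt_trans (cabsD _ _) _; rewrite !cabsM !cabsR !ger0_norm ?subr_ge0//.
  have -> : (1 - s) * cabs (a - p) + s * cabs (b - p) =
    cabs (a - p) + s * (cabs (b - p) - cabs (a - p)) by ring.
  have pos (x : C) : -1 < cabs x by rewrite (lt_le_trans _ (cabs_ge0 x))// ltrN10.
  by have /andP[] := itv_convex (x := cabs (a - p)) (y := cabs (b - p)) (t := s)
    (lo := -1) (hi := e) (introT andP (conj (pos _) Ba)) (introT andP (conj (pos _) Bb)) s01.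
- by rewrite mul0r addr0.
- by rewrite mul1r addrC subrK.
Qed.

(** Near p, the function alpha z - theta (- z) is a constant, equal to
    theta z - theta (- z) or to this difference plus 2 pi. The difference is - pi on
    one side of the slit and pi on the other, so the constant is pi. *)
Lemma crossing_gap u theta p (U : set C) (alpha : C -> R) : cabs u = 1 ->
  arg_branch 0 (cutA u) theta -> ray u p -> open U -> U p -> ~ U 0 ->
  arg_branch 0 U alpha ->
  (forall z, U z -> cutA u z -> theta z = alpha z \/ theta z = alpha z - 2 * pi) ->
  exists e : R, 0 < e /\ forall z, cabs (z - p) < e ->
    [/\ U z, cutA u (- z) & alpha z - theta (- z) = pi].
Proof.
move=> u1 br [rho hr pE] oU Up nU0 bra glue.
have ppi := pi_gt0 R; move: hr; rewrite /= in_itv /= => hr.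
have cNp : cutA u (- p).
  rewrite -pE -polar0 -polarDpi add0r; apply: polar_cutA => //.
  by apply/andP; split; lra.
have Up' : nbhs p (U `&` (fun z : C => - z) @^-1` cutA u).
  apply: filterI; first by apply: open_nbhs_nbhs.
  have nNp : nbhs (- p) (cutA u) by apply: open_nbhs_nbhs; split=> //; exact: open_cutA.
  have cN : {for p, continuous (fun z : C => - z)}.
    by apply: differentiable_continuous; apply: cdiffN; exact: cdiff_id.
  exact: cN nNp.
have [e [e0 he]] := (nbhs_cabsP _ _).1 Up'.
exists e; split=> // z ze; have [Uz cNz] := he z ze; split=> //.
pose B : set C := [set z | cabs (z - p) < e].
have pB : path_connected B by exact: ball_path_connected.
have cU w : U w -> w != 0 by move=> Uw; apply: contra_notN nU0 => /eqP <-.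
have [d dE] : exists d, forall w, B w -> (0 +i* (alpha w - theta (- w)))%C = d :> C.
  apply: (log_const (v := -1) pB) => w Bw; have [Uw cNw] := he w Bw.
    apply/(cvg_complexP (F := nbhs w)) => /=; split; first exact: cvg_cst.
    apply: cvgB.
      by have := bra.1; rewrite continuous_open_subspace//; apply; rewrite inE.
    apply: continuous_comp_opp.
    by have := br.1; rewrite continuous_open_subspace; [apply; rewrite inE|exact: open_cutA].
  have w0 : (cabs w)%:C%C != 0 :> C.
    by rewrite eq_complex /= eqxx andbT gt_eqF// cabs_gt0 cU.
  have h1 : w = (cabs w)%:C%C * cis (alpha w).
    by have := bra.2 w Uw; rewrite subr0 normE.
  have h2 : - w = (cabs w)%:C%C * cis (theta (- w)).
    by have := br.2 (- w) cNw; rewrite subr0 normrN normE.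
  rewrite -cis_exp; apply: (mulIf (cis_neq0 (theta (- w)))).
  rewrite -cisD subrK mulN1r; apply: (mulfI w0).
  by rewrite mulrN -h1 -h2 opprK.
have gap w : B w -> alpha w - theta (- w) = Im d by move=> /dE <-.
(* two points close to p, one on each side of the slit *)
have [s [s0 sp Bs Bs']] : exists s, [/\ 0 < s, s < pi, B (polar u rho s) &
    B (polar u rho (2 * pi - s))].
  have c0 : {for 0, continuous (polar u rho)}.
    have := @continuous_polar_path u rho 0 0 1 0.
    by under eq_fun do rewrite mulr0 addr0 mulr1 add0r.
  have nB : nbhs (polar u rho 0) B.
    by rewrite polar0 pE; apply/nbhs_cabsP; exists e.
  have /nbhs_ballP[dl dl0 hdl] := c0 _ nB.
  have /= dlp : 0 < dl by [].
  exists (Num.min (dl / 2) (pi / 2)).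
  have m1 : 0 < Num.min (dl / 2) (pi / 2) by rewrite lt_min !divr_gt0.
  have m2 : Num.min (dl / 2) (pi / 2) <= pi / 2 by rewrite ge_min lexx orbT.
  have m3 : Num.min (dl / 2) (pi / 2) <= dl / 2 by rewrite ge_min lexx.
  split=> //; first lra.
    by apply: hdl; rewrite -ball_normE /= sub0r normrN gtr0_norm//; lra.
  rewrite /polar cis2pi -/(polar u rho _); apply: hdl.
  by rewrite -ball_normE /= sub0r opprK gtr0_norm//; lra.
have c1 : cutA u (polar u rho s) by apply: polar_cutA => //; apply/andP; split; lra.
have c2 : cutA u (polar u rho (2 * pi - s)).
  by apply: polar_cutA => //; apply/andP; split; lra.
have t1 := theta_opposite u1 br hr (s := s).
have t2 := theta_opposite u1 br hr (s := pi - s).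
have g1 := gap _ Bs; have g2 := gap _ Bs'.
have e2 : 2 * pi - s = pi - s + pi by ring.
rewrite -polarDpi in g1; rewrite e2 in g2; rewrite e2 in c2 Bs'.
rewrite polarDpi opprK in g2; rewrite -polarDpi in g2.
have := glue _ (he _ Bs).1 c1; have := glue _ (he _ Bs').1 c2.
move: t1 t2; rewrite s0 sp subr_gt0 sp gtrBl s0 => /(_ isT) t1 /(_ isT) t2.
rewrite (gap z ze); lra.
Qed.

(** A change of coordinate by psi on one half of the annulus moves the factor
    psi 1 of the gluing automorphism to the opposite radius: each of the two
    opposite slits then carries the time-one map of a single flow. *)
Lemma bundle_of_annulus_extends (phi psi : C -> C2 R -> C2 R) (f : C2 R -> C2 R)
    (X : bundle (Some @` annulus r1 r2 : set S)) :
  hol_flow phi -> hol_flow psi -> (forall z, f z = psi 1 (phi 1 z)) ->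
  bundle_of_annulus f X ->
  exists Y : bundle (setT : set S), is_extension X Y /\
    forall (i j : index Y) p, (forall z, trans i j p z = z) \/
      exists s t, (forall z, trans i j p z = phi s (psi t z)) \/
        (forall z, trans i j p z = psi s (phi t z)).
Proof.
move=> fphi fpsi fE [u [u1' [tau [theta' [Ttau th' cross']]]]].
have u1 : cabs u = 1 by rewrite /cabs u1'.
have Nu1 : cabs (- u) = 1 by rewrite cabsN.
pose theta := theta' ord0.
have cutE : annulus r1 r2 `\` \bigcup_(j : 'I_1) ray u = cutA u.
  apply/seteqP; split=> z [Az nz]; split=> // h; apply: nz; first by exists ord0.
  by case: h.
have {}Ttau : trivialization (Some @` cutA u) tau by rewrite -cutE; exact: Ttau.
have th : arg_branch 0 (cutA u) theta by rewrite -cutE; exact: th'.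
have cross p : A p -> ray u p -> exists (U : set C) (alpha : C -> R) (sigma : X -> C2 R),
    [/\ open U, U p, arg_branch 0 U alpha, trivialization (Some @` U) sigma &
        forall e z, proj e = Some z -> U z -> cutA u z ->
          (theta z = alpha z /\ tau e = sigma e) \/
          (theta z = alpha z - 2 * pi /\ tau e = f (sigma e))].
  by rewrite -cutE; exact: (cross' ord0 p).
move: cross' th' => _ _.
have thN : arg_branch 0 (cutA (- u)) (fun z => theta (- z) + pi).
  have cN z : cutA (- u) z -> cutA u (- z).
    by move=> [Az nz]; split; [exact: AN|move=> /ray_opp].
  by apply: arg_branch_opp th; [exact: open_cutA|exact: open_cutA|exact: cN].
have [la [rhoa [da [hla drhoa laE]]]] := annulus_log u1 th.
have [lb [rhob [db [hlb drhob lbE]]]] := annulus_log Nu1 thN.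
pose w (j : 'I_2) := if j == ord0 then u else - u.
pose K (j : 'I_2) := slit (w j) @` `[0, 1].
pose F (j : 'I_2) := if j == ord0 then phi else psi.
pose l (j : 'I_2) (p : S) : C := (if j == ord0 then la p else lb p) / two_pi_i R.
have w1 j : cabs (w j) = 1 by rewrite /w; case: ifP.
have cK j : compact (K j) by exact: slit_compact.
have slit_disj z : (slit u @` `[0, 1]) z -> (slit (- u) @` `[0, 1]) z -> False.
  have pos (s : R) : 0 <= s <= 1 -> 0 < r1 + s * (r2 - r1).
    by move=> /andP[s0 _]; rewrite ltr_pwDl// mulr_ge0// subr_ge0 ltW.
  move=> [s]; rewrite /= in_itv /= => /pos s0 <- [t]; rewrite /= in_itv /= => /pos t0.
  rewrite !slitE mulrN => /eqP; rewrite eq_sym -addr_eq0 -mulrDl mulf_eq0.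
  rewrite -rmorphD -[u == 0]negbK -cabs_gt0 u1 ltr01 orbF /=.
  by rewrite eq_complex /= eqxx andbT gt_eqF// addr_gt0.
have dK : trivIset setT K.
  move=> i j _ _ [z []]; rewrite /K /w.
  case: (eqVneq i ord0) => [->|i0]; case: (eqVneq j ord0) => [->|j0] //= h1 h2.
  - by exfalso; exact: slit_disj h1 h2.
  - by exfalso; exact: slit_disj h2 h1.
  - apply: val_inj => /=; move: i0 j0; rewrite -!val_eqE /=.
    by case: i h1 => -[|[|]] //; case: j h2 => -[|[|]].
have fF j : hol_flow (F j) by rewrite /F; case: ifP.
have hl j p : ~ (Some @` K j : set S) p -> hol1_at (l j) p.
  rewrite /K /w /l; case: ifP => _ nK.
    by have := hla p nK; case: p nK => [a|] _ h; apply: cdiffM => //; exact: cdiff_cst.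
  by have := hlb p nK; case: p nK => [a|] _ h; apply: cdiffM => //; exact: cdiff_cst.
pose cut2 : set C := A `\` \bigcup_j K j.
have cut2E z : cut2 z <-> [/\ cutA u z, cutA u (- z) & ~ ray (- u) z].
  split=> [[Az nz]|[[Az nz] cNz nNz]].
    have n1 : ~ ray u z by move=> /ray_slit h; apply: nz; exists ord0.
    have n2 : ~ ray (- u) z by move=> /ray_slit h; apply: nz; exists ord_max.
    by split=> //; split; [exact: AN|move=> /ray_opp].
  split=> // -[j _]; rewrite /K /w; case: ifP => _.
    by move/(slit_ray u1 Az).
  by move/(slit_ray Nu1 Az).
have ocut2 : open cut2.
  apply: openI => //; apply: closed_openC; apply: closed_bigcup; first exact: finite_finset.
  by move=> j _; apply: compact_closed; [exact: C_hausdorff|exact: cK].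
have ppi := pi_gt0 R.
have jump z : cut2 z -> theta z - theta (- z) = pi \/ theta z - theta (- z) = - pi.
  by move=> /cut2E[cz _ nz]; exact: antipodal_jump u1 th cz nz.
(* the coordinate is changed by psi (- 1) where theta is below its antipode *)
pose tt (p : S) : C := if p is Some z then (if theta (- z) < theta z then 0 else - 1) else 0.
have htt p : (Some @` cut2 : set S) p -> hol1_at tt p.
  move=> [z cz <-].
  have cD : {for z, continuous (fun z : C => theta z - theta (- z))}.
    have thc y : cutA u y -> {for y, continuous theta}.
      have := th.1; rewrite continuous_open_subspace; last exact: open_cutA.
      by move=> h cy; apply: h; rewrite inE.
    have /cut2E[c1 c2 _] := cz.
    exact: (cvgB (thc z c1) (continuous_comp_opp (thc _ c2))).
  apply: (@differentiable_near R _ _ _ (fun=> tt (Some z))); last exact: cdiff_cst.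
  have [D|D] := jump z cz.
    have : \forall y \near z, 0 < theta y - theta (- y).
      by apply: (cvgr_gt (theta z - theta (- z))) cD _ _; rewrite D.
    apply: filterS => y; rewrite subr_gt0 /tt => ->.
    by have -> : theta (- z) < theta z by rewrite -subr_gt0 D.
  have : \forall y \near z, theta y - theta (- y) < 0.
    by apply: (cvgr_lt (theta z - theta (- z))) cD _ _; rewrite D oppr_lt0.
  apply: filterS => y; rewrite subr_lt0 /tt => /lt_gtF ->.
  have /lt_gtF -> // : theta z < theta (- z).
  by rewrite -subr_lt0 D oppr_lt0.
pose tau2 (e : X) := psi (tt (proj e)) (tau e).
have hpsi (U : set S) (m : S -> C) : (forall p, U p -> hol1_at m p) ->
    hol_over U (fun p z => psi (m p) z).
  by apply: hol_over_param; case: fpsi.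
have Ttau2 : trivialization (Some @` (A `\` \bigcup_j K j)) tau2.
  apply: (triv_post (g := fun p => psi (tt p)) (h := fun p => psi (- tt p))).
  - exact: hpsi.
  - by apply: (hpsi _ (fun p => - tt p)) => p /htt; exact: hol1_atN.
  - by move=> p _; exact: hol_flowK.
  - by move=> p _; exact: hol_flowNK.
  - apply: triv_sub Ttau; first exact/open_Some.
    by apply: image_subset => z /cut2E[].
have psi0 v : psi 0 v = v by case: fpsi.
have psiN v : psi (- 1) (psi 1 v) = v := hol_flowK 1 fpsi v.
have psiNN v : psi 1 (psi (- 1) v) = v := hol_flowNK 1 fpsi v.
have UA (U : set C) sigma : trivialization (Some @` U) (sigma : X -> C2 R) -> U `<=` A.
  move=> T z Uz; have Uz' : (Some @` U : set S) (Some z) by exists z.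
  have [e [ep _]] := triv_surj 0 T Uz'.
  by have [y Ay ye] := proj_base e; move: ye; rewrite ep => -[<-].
have nA0 : ~ A 0 by move=> /AE; rewrite /cabs normr0 /= ltNge (ltW r10).
have nearslit p : A p -> ray u p -> exists (e : R) (alpha : C -> R) (sigma : X -> C2 R),
    0 < e /\ let B : set C := [set z | cabs (z - p) < e] in
    [/\ open B, arg_branch 0 B alpha, trivialization (Some @` B) sigma,
        forall z, B z -> cutA u (- z) &
        forall x z, proj x = Some z -> cut2 z -> B z ->
          (theta z = alpha z /\ tau2 x = sigma x /\ theta z - theta (- z) = pi) \/
          (theta z = alpha z - 2 * pi /\ tau2 x = phi 1 (sigma x) /\
             theta z - theta (- z) = - pi)].
  move=> Ap rp; have [U [alpha [sigma [oU Up bra Ts glue]]]] := cross p Ap rp.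
  have U0 : ~ U 0 by move=> /(UA U sigma Ts).
  have glue' z : U z -> cutA u z -> theta z = alpha z \/ theta z = alpha z - 2 * pi.
    move=> Uz cz; have Uz' : (Some @` U : set S) (Some z) by exists z.
    have [e [ep _]] := triv_surj 0 Ts Uz'.
    by case: (glue e z ep Uz cz) => -[-> _]; [left|right].
  have [e [e0 he]] := crossing_gap u1 th rp oU Up U0 bra glue'.
  exists e, alpha, sigma; split=> //; set B := [set z | _].
  have BU : B `<=` U by move=> z /he[].
  have oB : open B := @open_cabs_ball p e.
  split=> //.
  - split; first exact: continuous_subspaceW BU bra.1.
    by move=> z /BU; exact: bra.2.
  - by apply: triv_sub Ts; [exact/open_Some|exact: image_subset].
  - by move=> z /he[].
  - move=> x z xz cz Bz; have [Uz _ gap] := he z Bz; have /cut2E[cuz _ _] := cz.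
    rewrite /tau2 xz /tt; case: (glue x z xz Uz cuz) => -[t1 t2]; [left|right].
      split=> //; have -> : theta (- z) < theta z by rewrite -subr_gt0 t1 gap.
      by rewrite psi0 t1 gap.
    have D : theta z - theta (- z) = - pi by rewrite t1; lra.
    have /lt_gtF -> : theta z < theta (- z) by rewrite -subr_lt0 D oppr_lt0.
    by rewrite t2 fE psiN.
have [||s sP] := flow_bundle_charts cK dK fF hl Ttau2.
- move=> j p U Ap Kp Up.
  exact: arc_dense (@slit_continuous (w j)) (slit_inj (w1 j)) Up.
- move=> j p Ap; rewrite /K /w /F /l; case: ifP => _ Kp.
    have [e [alpha [sigma [e0 [oB brB TB cB glue]]]]] := nearslit p Ap (slit_ray u1 Ap Kp).
    exists [set z | cabs (z - p) < e],
      (fun z => (log_of_arg 0 alpha z + (rhoa z + da)) / two_pi_i R), sigma.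
    split; [exact: oB|by rewrite /= subrr /cabs normr0| |exact: TB|].
      move=> z Bz; apply: cdiffM; last exact: cdiff_cst.
      apply: cdiffD.
        apply: (differentiable_log_of_arg oB brB) => // B0; apply: nA0.
        exact: (UA _ sigma TB).
      by apply: cdiffD; [apply: drhoa; exact: (UA _ sigma TB)|exact: cdiff_cst].
    move=> x z xz Bz cz; have /cut2E[cuz _ _] := cz; rewrite laE//.
    apply: flow_crossing => //.
    by case: (glue x z xz cz Bz) => -[t1 [t2 _]]; [left|right].
  have rNp : ray u (- p) by apply/ray_opp; exact: slit_ray Nu1 Ap Kp.
  have [e [alpha [sigma [e0 [oB brB TB cB glue]]]]] := nearslit (- p) (AN Ap) rNp.
  have BN z : cabs (z - p) < e -> cabs (- z - - p) < e.
    by rewrite opprK -cabsN opprD opprK.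
  pose B : set C := [set z | cabs (z - p) < e].
  have oN : open B := @open_cabs_ball p e.
  have BcutA z : B z -> cutA u z by move=> /BN /cB; rewrite opprK.
  have brN : arg_branch 0 B (fun z => alpha (- z) + pi).
    by apply: arg_branch_opp brB; [exact: oB|exact: oN|exact: BN].
  exists B, (fun z => (log_of_arg 0 (fun z => alpha (- z) + pi) z + (rhob z + db)) / two_pi_i R),
    (fun x => psi (- 1) (tau x)).
  split; [exact: oN|by rewrite /B /= subrr /cabs normr0| | |].
  + move=> z Bz; have Az : A z by case: (BcutA z Bz).
    apply: cdiffM; last exact: cdiff_cst.
    apply: cdiffD.
      by apply: (differentiable_log_of_arg oN brN) => // /BcutA[].
    by apply: cdiffD; [exact: drhob|exact: cdiff_cst].
  + have cst1 (c : C) (U : set S) p' : U p' -> hol1_at (fun=> c) p'.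
      by case: p' => [a|] _; exact: cdiff_cst.
    apply: (triv_post (g := fun=> psi (- 1)) (h := fun=> psi 1)).
    * by apply: (hpsi _ (fun=> - 1)) => p'; exact: cst1.
    * by apply: (hpsi _ (fun=> 1)) => p'; exact: cst1.
    * by move=> _ _; exact: psiNN.
    * by move=> _ _; exact: psiN.
    * by apply: triv_sub Ttau; [exact/open_Some|exact: image_subset].
  + move=> x z xz Bz cz; have /cut2E[cuz cNz nz] := cz.
    rewrite lbE; last by case: cuz.
    apply: flow_crossing => //.
    have cN2 : cut2 (- z).
      apply/cut2E; rewrite opprK; split=> //; first by move/ray_opp; rewrite opprK; case: cuz.
    have BNz := BN z Bz; have BNz' : (Some @` [set z | cabs (z - - p) < e] : set S) (Some (- z)).
      by exists (- z).
    have [y [yz _]] := triv_surj 0 TB BNz'.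
    rewrite /tau2 xz /tt; case: (glue y (- z) yz cN2 BNz) => -[t1 [_]]; rewrite opprK => D.
      left; have /lt_gtF -> : theta z < theta (- z) by rewrite -subr_gt0 D.
      by rewrite t1.
    right; have -> : theta (- z) < theta z by rewrite -subr_lt0 D oppr_lt0.
    by rewrite t1 psi0 psiNN; split=> //; ring.
- exists (flow_bundle cK dK fF hl); split; first exact: charts_on_is_extension sP.
  move=> i j p; rewrite flow_bundle_trans /flow_trans; case: eqVneq => [_|ij]; first by left.
  right; exists (l i p), (- l j p); rewrite /F; move: ij.
  case: (eqVneq i ord0) => [->|i0]; case: (eqVneq j ord0) => [->|j0] // ij.
  + by left.
  + by right.
  + exfalso; move: i0 j0 ij; rewrite -!val_eqE /=.
    by case: i => -[|[|]] //; case: j => -[|[|]].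
Qed.

End Annulus.

(** * The extension theorems *)

(** The factors of the Henon map: the rotation (z1, z2) |-> (z2, - z1), in a
    linear flow, and the shear (z1, z2) |-> (z1, z2 + z1 ^ k). *)
Lemma henon_extends (R : realType) (k : nat) (r1 r2 : R)
    (X : bundle (Some @` annulus r1 r2 : set (sphere R))) :
  0 < r1 -> r1 < r2 -> bundle_of_annulus (@henon R k) X ->
  exists Y : bundle (setT : set (sphere R)), is_extension X Y /\ polynomial_gluing Y.
Proof.
move=> r10 r12 hX.
have n1 : (- 1 : Cplx R) != 0 by rewrite oppr_eq0 oner_neq0.
have [phi [fphi phi1 lphi]] := antidiagonal_flow (oner_neq0 (Cplx R)) n1.
have fpsi := poly_shear_flow R k.
have fE z : henon k z = poly_shear k 1 (phi 1 z).
  by rewrite phi1 /henon /poly_shear /= !mul1r mulN1r.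
have [Y [ext tr]] := bundle_of_annulus_extends r10 r12 fphi fpsi fE hX.
exists Y; split=> // i j p Di Dj; have pid := @polynomial_map_id R.
have pphi t f : polynomial_map f -> polynomial_map (fun z => phi t (f z)).
  exact: linear_polynomial_map.
have ppsi t f : polynomial_map f -> polynomial_map (fun z => poly_shear k t (f z)).
  exact: poly_shear_polynomial_map.
have [e|[s [t [e|e]]]] := tr i j p.
- have -> : trans i j p = id by apply/funext.
  by split=> //; exists id.
- have -> : trans i j p = fun z => phi s (poly_shear k t z) by apply/funext.
  split; first by apply: pphi; exact: ppsi.
  exists (fun z => poly_shear k (- t) (phi (- s) z)); split.
  + by apply: ppsi; exact: pphi.
  + by move=> z; rewrite (hol_flowK s fphi) (hol_flowK t fpsi).
  + by move=> z; rewrite (hol_flowNK t fpsi) (hol_flowNK s fphi).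
- have -> : trans i j p = fun z => poly_shear k s (phi t z) by apply/funext.
  split; first by apply: ppsi; exact: pphi.
  exists (fun z => phi (- t) (poly_shear k (- s) z)); split.
  + by apply: pphi; exact: ppsi.
  + by move=> z; rewrite (hol_flowK s fpsi) (hol_flowK t fphi).
  + by move=> z; rewrite (hol_flowNK t fphi) (hol_flowNK s fpsi).
Qed.

Theorem mainTheorem2 (R : realType) :
  (forall (c : 'I_8 -> Cplx R) (rho : 'I_8 -> R) (f : 'I_8 -> C2 R -> C2 R)
     (X : bundle (Some @` holed_disc c rho : set (sphere R))),
     (forall j, overshear (f j)) -> bundle_of_holes f X ->
     extends_to X setT /\ extends_to X (Some @` @unit_disc R)) /\
  (forall (c : 'I_2 -> Cplx R) (rho : 'I_2 -> R)
     (X : bundle (Some @` holed_disc c rho : set (sphere R))),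
     bundle_of_holes
       (fun j => if j == ord0 then @skoda_shear R else @skoda_rotation R) X ->
     extends_to X setT /\ extends_to X (Some @` @unit_disc R)) /\
  (forall (k : nat) (r1 r2 : R)
     (X : bundle (Some @` annulus r1 r2 : set (sphere R))),
     (2 <= k)%N -> 0 < r1 -> r1 < r2 -> bundle_of_annulus (@henon R k) X ->
     exists Y : bundle (setT : set (sphere R)),
       is_extension X Y /\ polynomial_gluing Y).
Proof.
split; [|split].
- move=> c rho f X shears; apply: bundle_of_holes_extends => j.
  exact: overshear_flow.
- move=> c rho X; apply: bundle_of_holes_extends => j; case: ifP => _.
    apply: overshear_flow; exists id; split; first exact: cdiff_id.
    by left.
  have i0 : 'i%C != 0 :> Cplx R by rewrite eq_complex /= oner_eq0 andbF.
  have [phi [fphi phi1 _]] := antidiagonal_flow i0 (oner_neq0 (Cplx R)).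
  by exists phi; split=> // z; rewrite phi1 mul1r.
- by move=> k r1 r2 X _; exact: henon_extends.
Qed.
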